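(* Let $r:I\to[0,+\infty[$ be right continuous on $[0,T[$ and nondecreasing, with $r(0)=0$ and $r(T)<+\infty$. Let $C:I\rightrightarrows E$ be a set-valued mapping with nonempty closed convex values such that $d_H(C(t),C(\tau))\le r(t)-r(\tau)$ for all $\tau\le t$ in $I$, and such that each $C(t)$ is ball-compact (its intersection with any closed ball of $E$ is compact). Let $f:I\to E$ be a bounded $\lambda$-measurable mapping. Then for every $u_0\in C(0)$ there is a unique BVRC solution $u$ to the evolution problem $$\begin{cases}u(0)=u_0;\\ u(t)\in C(t)\quad\forall t\in I;\\ \frac{du}{d\nu}\in L^\infty(I,E;d\nu);\\ -\frac{du}{d\nu}(t)\in N_{C(t)}(u(t))+f(t)\frac{d\lambda}{d\nu}(t)\quad\nu\text{-a.e. }t\in I.\end{cases}$$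
   Context: $E$ is a separable real Hilbert space; $I=[0,T]$ with $T>0$; $\lambda$ is Lebesgue measure on $I$. For closed sets, $e(C_1,C_2)=\sup_{x\in C_1}d(x,C_2)$ and $d_H(C_1,C_2)=\max\{e(C_1,C_2),e(C_2,C_1)\}$. $N_{C}$ is the normal cone of convex analysis, $N_C=\partial\delta_C$ (the subdifferential of the indicator function of $C$). $dr$ is the Stieltjes measure on $I$ associated with $r$ ($dr(]s,t])=r(t)-r(s)$), $\nu:=\lambda+dr$, and $\frac{d\lambda}{d\nu}$ is the density of $\lambda$ with respect to $\nu$. BVRC means of bounded variation and right continuous. $\frac{du}{d\nu}$ denotes the density with respect to $\nu$ of the differential measure $du$ of $u$ ($du(]s,t])=u(t)-u(s)$), i.e. $u(t)=u(0)+\int_{]0,t]}\frac{du}{d\nu}\,d\nu$; being a solution includes the existence of this density. *)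

(* Defs.v *)
From HB Require Import structures.
From mathcomp Require Import all_boot all_order all_algebra.
From mathcomp Require Import all_classical all_reals all_analysis ess_sup_inf.
Import Order.TTheory GRing.Theory Num.Theory.
Import numFieldNormedType.Exports.

Set Implicit Arguments.
Unset Strict Implicit.
Unset Printing Implicit Defensive.

Local Open Scope classical_set_scope.
Local Open Scope ring_scope.
Local Open Scope charge_scope.

Definition separable (V : topologicalType) : Prop :=
  exists2 A : set V, countable A & dense A.

(* A real Hilbert space is represented by a complete normed module together
   with an inner product [ip : {dot E for idfun}] inducing its norm. *)
Definition norm_from_dot (R : realType) (E : normedModType R)
    (ip : {dot E for (@idfun R)}) : Prop :=
  forall x : E, `|x| = Num.sqrt (ip x x).

Section ConvexAnalysis.
Context {R : realType} {E : normedModType R}.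

(* Extended-real-valued: neither quantity need be finite. *)
Definition excess (C1 C2 : set E) : \bar R :=
  ereal_sup [set edist_inf C2 x | x in C1].

Definition hausdorff_dist (C1 C2 : set E) : \bar R :=
  maxe (excess C1 C2) (excess C2 C1).

Definition ball_compact (C : set E) : Prop :=
  forall (x : E) (rho : R), compact (C `&` closed_ball_ Num.norm x rho).

Definition indicator (C : set E) (x : E) : \bar R :=
  if x \in C then 0%E else +oo%E.

Definition subdifferential (ip : {dot E for (@idfun R)}) (phi : E -> \bar R)
    (x : E) : set E :=
  [set xi | phi x \is a fin_num /\
            forall y, (phi x + (ip xi (y - x))%:E <= phi y)%E].

Definition normal_cone (ip : {dot E for (@idfun R)}) (C : set E) (x : E) :
    set E :=
  subdifferential ip (indicator C) x.

End ConvexAnalysis.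

Section BVRC.
Context {R : realType}.

(* Functions on I = [0, T] are functions on R whose values outside I are
   irrelevant; right continuity at T relative to I is vacuous. *)
Definition right_continuous_on (V : topologicalType) (T : R) (u : R -> V) :
    Prop :=
  forall t, 0 <= t -> t < T -> u s @[s --> t^'+] --> u t.

(* The library's [variation] and [bounded_variation] are restricted to
   real-valued functions. *)
Definition vector_variation (E : normedModType R) (a b : R) (u : R -> E)
    (s : seq R) : R :=
  let F := u \o nth b (a :: s) in
  \sum_(0 <= n < size s) `|F n.+1 - F n|.

Definition vector_bounded_variation (E : normedModType R) (a b : R)
    (u : R -> E) : Prop :=
  has_ubound [set vector_variation a b u s | s in itv_partition a b].

Definition BVRC (E : normedModType R) (T : R) (u : R -> E) : Prop :=
  vector_bounded_variation 0 T u /\ right_continuous_on T u.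

End BVRC.

Section Bochner.
Context d (X : measurableType d) {R : realType} {E : normedModType R}.
Variable mu : {finite_measure set X -> \bar R}.

Definition simple_fun (s : X -> E) : Prop :=
  finite_set (range s) /\ forall y, measurable (s @^-1` [set y]).

Definition simple_integral (D : set X) (s : X -> E) : E :=
  \sum_(y \in range s) fine (mu (D `&` s @^-1` [set y])) *: y.

(* Measurability with respect to [mu] (i.e. to its completion). *)
Definition strongly_measurable (g : X -> E) : Prop :=
  exists s_ : nat -> X -> E,
    (forall n, simple_fun (s_ n)) /\
    {ae mu, forall x, s_ n x @[n --> \oo] --> g x}.

Definition is_bochner_integral (D : set X) (g : X -> E) (v : E) : Prop :=
  strongly_measurable g /\
  exists s_ : nat -> X -> E,
    [/\ forall n, simple_fun (s_ n),
        (\int[mu]_(x in D) `|g x - s_ n x|%:E)%E @[n --> \oo] --> 0%E &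
        simple_integral D (s_ n) @[n --> \oo] --> v].

Definition in_Linfty (g : X -> E) : Prop :=
  strongly_measurable g /\ (ess_sup mu (fun x => `|g x|%:E) < +oo)%E.

End Bochner.

Section Measures.
Context {R : realType}.
Variable T : R.

Let lebesgue_fin : (@lebesgue_measure R `[0%R, T]%classic < +oo)%E.
Proof. by rewrite lebesgue_measure_itv; case: ifP => //= _; rewrite ltry. Qed.

(* All measures on I are measures on R carried by I. *)
Definition lebesgue_on : set (measurableTypeR R) -> \bar R :=
  @mfrestr _ (measurableTypeR R) R `[0, T]%classic _
    (measurable_itv `[0, T]) lebesgue_fin.

HB.instance Definition _ := FiniteMeasure.on lebesgue_on.

Hypothesis T_gt0 : 0 < T.
Variable r : R -> R.
Hypothesis r_nd : {in `[0, T] &, {homo r : s t / s <= t}}.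
Hypothesis r_rc : right_continuous_on T r.

(* [r] extended by the constants [r 0] on the left of 0 and [r T] on the right
   of T; the extension puts no mass at 0 nor outside I. *)
Definition extension of 0 < T & {in `[0, T] &, {homo r : s t / s <= t}}
    & right_continuous_on T r : R -> R :=
  fun t => r (Num.max 0 (Num.min t T)).

Local Notation rI := (extension T_gt0 r_nd r_rc).

Let extension_nd : nondecreasing rI.
Proof.
move=> s t st; apply: r_nd.
- by rewrite in_itv/= le_max lexx/= ge_max (ltW T_gt0) ge_min lexx orbT.
- by rewrite in_itv/= le_max lexx/= ge_max (ltW T_gt0) ge_min lexx orbT.
- by rewrite ge_max !le_max lexx/= le_min !ge_min st lexx !orbT.
Qed.

Let extension_rc : right_continuous rI.
Proof.
move=> t; have [t0|t0] := ltP t 0.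
  have -> : rI t = r 0.
    by rewrite /extension max_l// ge_min (ltW t0).
  apply: cvg_near_cst; near=> s.
  rewrite /extension max_l// ge_min; apply/orP; left.
  by near: s; exact: nbhs_right_le.
have [tT|tT] := ltP t T.
  have -> : rI t = r t by rewrite /extension (min_l (ltW tT)) max_r.
  apply: cvg_trans (r_rc t0 tT); apply: near_eq_cvg; near=> s.
  rewrite /extension min_l ?max_r//.
    by apply: (le_trans t0); near: s; exact: nbhs_right_ge.
  by near: s; exact: nbhs_right_le.
have -> : rI t = r T by rewrite /extension min_r// max_r// ltW.
apply: cvg_near_cst; near=> s.
rewrite /extension min_r ?max_r ?(ltW T_gt0)//.
by apply: (le_trans tT); near: s; exact: nbhs_right_ge.
Unshelve. all: by end_near. Qed.

HB.instance Definition _ :=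
  isCumulative.Build R _ R rI extension_nd extension_rc.

Let stieltjes_fin : (lebesgue_stieltjes_measure rI `[0%R, T]%classic < +oo)%E.
Proof.
apply: (@le_lt_trans _ _ (lebesgue_stieltjes_measure rI `](-1)%R, T]%classic)).
  apply: le_measure; rewrite ?inE; [exact: measurable_itv..|].
  by apply: subset_itvr; rewrite bnd_simp ltrN10.
rewrite /lebesgue_stieltjes_measure /= /measure_extension measurable_mu_extE/=.
  by rewrite wlength_itv_bnd ?ltry//= (le_trans _ (ltW T_gt0)).
exact: is_ocitv.
Qed.

Definition stieltjes_on : set (measurableTypeR R) -> \bar R :=
  @mfrestr _ (measurableTypeR R) R `[0, T]%classic _
    (measurable_itv `[0, T]) stieltjes_fin.

HB.instance Definition _ := FiniteMeasure.on stieltjes_on.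

Definition nu_on : set (measurableTypeR R) -> \bar R :=
  measure_add lebesgue_on stieltjes_on.

HB.instance Definition _ := Measure.on nu_on.

Let nu_on_fin : fin_num_fun nu_on.
Proof.
move=> A mA; rewrite /nu_on measure_addE fin_numD.
by rewrite !fin_num_measure.
Qed.

HB.instance Definition _ := Measure_isFinite.Build _ _ _ nu_on nu_on_fin.

Lemma stieltjes_on_itv s t : 0 <= s -> s <= t -> t <= T ->
  stieltjes_on `]s, t]%classic = (r t - r s)%:E.
Proof.
move=> s0 st tT; rewrite /stieltjes_on /mfrestr /mrestr setIidl; last first.
  by apply: subset_itv; rewrite bnd_simp.
rewrite /lebesgue_stieltjes_measure /= /measure_extension measurable_mu_extE/=.
  rewrite wlength_itv_bnd// /extension !min_l ?(le_trans st)//.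
  by rewrite !max_r ?(le_trans s0).
exact: is_ocitv.
Qed.

Lemma stieltjes_on_set1 : stieltjes_on [set 0] = 0%E.
Proof.
apply/eqP; rewrite -measure_le0.
have -> : 0%E = lebesgue_stieltjes_measure rI `](-1)%R, 0%R]%classic.
  rewrite /lebesgue_stieltjes_measure /= /measure_extension.
  rewrite measurable_mu_extE/=; last exact: is_ocitv.
  rewrite wlength_itv_bnd ?lerN10// /extension !max_l ?subrr//.
    by rewrite ge_min lerN10.
  by rewrite ge_min lexx.
apply: le_measure; rewrite ?inE; [|exact: measurable_itv|].
- by apply: measurableI; [exact: measurable_set1|exact: measurable_itv].
- by move=> x [-> _] /=; rewrite in_itv/= ltrN10 lexx.
Qed.

Lemma lebesgue_on_dominates :
  charge_of_finite_measure lebesgue_on `<< nu_on.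
Proof.
apply/null_content_dominatesP => A mA.
rewrite -[X in X = _ -> _]/(nu_on A) /nu_on measure_addE => /eqP.
by rewrite padde_eq0 ?measure_ge0// => /andP[/eqP].
Qed.

End Measures.

Section EvolutionProblem.
Context {R : realType} {E : normedModType R}.
Variables (ip : {dot E for (@idfun R)}) (T : R).
Variable nu : {finite_measure set (measurableTypeR R) -> \bar R}.

Definition is_density (u g : R -> E) : Prop :=
  forall t, 0 <= t -> t <= T ->
    is_bochner_integral nu `]0, t]%classic g (u t - u 0).

Definition dlambda_dnu (t : R) : R :=
  fine (('d (charge_of_finite_measure (lebesgue_on T)) '/d nu) t).

Definition evolution_solution (C : R -> set E) (f : R -> E) (u0 : E)
    (u : R -> E) : Prop :=
  [/\ u 0 = u0,
      forall t, 0 <= t -> t <= T -> C t (u t) &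
      exists g : R -> E,
        [/\ is_density u g,
            in_Linfty nu g &
            {ae nu, forall t, 0 <= t <= T ->
              [set xi + dlambda_dnu t *: f t
                | xi in normal_cone ip (C t) (u t)] (- g t)}]].

End EvolutionProblem.

(* Main.v *)
(** Put [rho t = t + r t], so that [nu ]s, t] = rho t - rho s].

    Existence. Adding to the solution the primitive of the perturbation
    [f dlambda/dnu], and translating the sets accordingly, reduces to [f = 0]. For
    a finite grid, project successively on the sets at the grid points; refining
    the grids along an ultrafilter, ball-compactness yields a limit [w] with
    [|w t - w s| <= K (rho t - rho s)] and, for [a < t <= b] and [y] in the moving
    set at [t],
    [<y - w t, w b - w a> >= - 2 K^2 nu(]a, b]) nu(]a, b] \ {t})].
    The difference quotients of [w] on the dyadic intervals form a bounded
    martingale for [nu]; its increments are orthogonal in L2, so a subsequence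
    converges a.e. to a density [g] of [w]. Dividing the inequality by [nu(]a, b])]
    on the dyadic interval containing [t] and letting it shrink gives
    [<y - w t, g t> >= 0], because [nu(]a, b] \ {t}) -> 0].

    Uniqueness. If [z] is the difference of two solutions and [k] its density, then
    [<k t, z t> <= 0] a.e., while summing [|z b|^2 - |z a|^2 <= 2 <z b, z b - z a>]
    over dyadic intervals gives [|z t|^2 <= 2 int_]0, t] <k, z> dnu] in the limit,
    by right continuity of [z]. *)
Require Import Defs.
From HB Require Import structures.
From mathcomp Require Import all_boot all_order all_algebra.
From mathcomp Require Import all_classical all_reals all_analysis.
From mathcomp Require Import measurable_realfun ess_sup_inf zify ring lra.
Import Order.TTheory GRing.Theory Num.Theory.
Import numFieldNormedType.Exports HBNNSimple.
Set Implicit Arguments.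
Unset Strict Implicit.
Unset Printing Implicit Defensive.
Local Open Scope classical_set_scope.
Local Open Scope ring_scope.

(** The measure [nu] may have atoms, so the mass of the dyadic interval around [t] need not tend to
    [0], and every error has to vanish without help from the mass at [t]. For existence, this is why
    the projection landing on [t] is kept exact. For uniqueness, it dictates sampling [z] at the
    right end [b]: the identity [|z b|^2 - |z a|^2 = 2 <z b, z b - z a> - |z b - z a|^2] has a
    remainder of the good sign, whereas sampling at [a] leaves one of the bad sign that survives a
    jump. Adding [t] to [r t] makes [rho] strictly increasing, so every dyadic interval has positive
    mass and the difference quotients make sense. Vector integrals are tested against a fixed [z],
    which turns equalities and norm bounds into statements on real integrals. *)

(** * Inner product and projection on ball-compact convex sets *)

Section Hilbert.
Context {R : realType} {E : normedModType R} (ip : {dot E for (@idfun R)}).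
Hypothesis ip_norm : norm_from_dot ip.

Lemma dot_sym x y : ip x y = ip y x.
Proof. by rewrite (hermC ip) expr0 mul1r. Qed.

Lemma dot_ge0 x : 0 <= ip x x.
Proof.
by have [->|x0] := eqVneq x 0; [rewrite linear0l | exact/ltW/neq0_dnorm_gt0].
Qed.

Lemma dot_norm x : ip x x = `|x| ^+ 2.
Proof. by rewrite ip_norm sqr_sqrtr// dot_ge0. Qed.

Lemma dotDl x y z : ip (x + y) z = ip x z + ip y z.
Proof. exact: linearDl. Qed.
Lemma dotDr x y z : ip z (x + y) = ip z x + ip z y.
Proof. exact: linearDr. Qed.
Lemma dotNl x z : ip (- x) z = - ip x z.
Proof. exact: linearNl. Qed.
Lemma dotNr x z : ip z (- x) = - ip z x.
Proof. exact: linearNr. Qed.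
Lemma dotZl a x z : ip (a *: x) z = a * ip x z.
Proof. exact: linearZl_LR. Qed.
Lemma dotZr a x z : ip z (a *: x) = a * ip z x.
Proof. by rewrite dot_sym dotZl dot_sym. Qed.

Lemma cauchy_schwarz x y : `|ip x y| <= `|x| * `|y|.
Proof.
have [->|y0] := eqVneq y 0; first by rewrite linear0r !normr0 mulr0.
have ny : 0 < `|y| by rewrite normr_gt0.
(* The usual residual is multiplied by [|y|^2] to avoid a division; its squared norm is [|y|^2]
   times the gap to be shown nonnegative. *)
have h := dot_ge0 (`|y| ^+ 2 *: x - ip x y *: y).
have h2 : 0 <= `|y| ^+ 2 * (`|x| ^+ 2 * `|y| ^+ 2 - ip x y ^+ 2).
  apply: (le_trans h); rewrite le_eqVlt; apply/orP; left; apply/eqP.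
  rewrite !(dotDl, dotDr, dotNl, dotNr, dotZl, dotZr) (dot_sym y x) !dot_norm.
  by ring.
rewrite pmulr_rge0 ?exprn_gt0// subr_ge0 -exprMn in h2.
by rewrite -(@ler_pXn2r _ 2) ?nnegrE ?mulr_ge0// real_normK ?num_real.
Qed.

Lemma dot_ler x y : ip x y <= `|x| * `|y|.
Proof. exact: le_trans (ler_norm _) (cauchy_schwarz x y). Qed.

Lemma dot_lerN x y : - (`|x| * `|y|) <= ip x y.
Proof.
by rewrite lerNl; apply: le_trans (cauchy_schwarz x y); rewrite -normrN ler_norm.
Qed.

Lemma normB_sqr x y : `|x - y| ^+ 2 = `|x| ^+ 2 + `|y| ^+ 2 - 2 * ip x y.
Proof.
by rewrite -!dot_norm !(dotDl, dotDr, dotNl, dotNr) (dot_sym y x); ring.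
Qed.

Lemma cvg_dot (T : Type) (F : set_system T) {FF : Filter F} (u v : T -> E) a b :
  u @ F --> a -> v @ F --> b -> (fun t => ip (u t) (v t)) @ F --> ip a b.
Proof.
(* Polarization: continuity of the inner product is inherited from that of the norm. *)
have pol x y : ip x y = 2^-1 * (`|x| ^+ 2 + `|y| ^+ 2 - `|x - y| ^+ 2).
  by rewrite normB_sqr; field.
move=> ua vb; rewrite pol; under eq_fun do rewrite pol.
have sq (w : T -> E) c : w @ F --> c -> (fun t => `|w t| ^+ 2) @ F --> `|c| ^+ 2.
  by move=> wc; under eq_fun do rewrite expr2; apply: cvgM; exact: cvg_norm.
apply: cvgM; first exact: cvg_cst.
by apply: cvgB; [apply: cvgD|]; apply: sq => //; exact: cvgB.
Qed.

Lemma dot_weak_eq (x y : E) : (forall z, ip x z = ip y z) -> x = y.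
Proof.
move=> xy; apply/eqP; rewrite -subr_eq0 -normr_eq0 -sqrf_eq0 -dot_norm.
by rewrite dotDl dotNl xy subrr.
Qed.

Lemma dot_weak_norm (x : E) (m : R) : 0 <= m ->
  (forall z, ip x z <= m * `|z|) -> `|x| <= m.
Proof.
move=> m0 /(_ x); rewrite dot_norm expr2.
have [->|x0] := eqVneq x 0; first by rewrite normr0.
by rewrite ler_pM2r// normr_gt0.
Qed.

(** Only the points of [A] at least as close to [x] as a given [a] compete, and they form a compact
    set. *)
Lemma nearest_point (A : set E) (x : E) : A !=set0 -> ball_compact A ->
  exists2 p, A p & forall y, A y -> `|x - p| <= `|x - y|.
Proof.
move=> [a Aa] cA; set B := A `&` closed_ball_ Num.norm x `|x - a|.
have Ba : B a by split=> //=; rewrite /closed_ball_/=.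
have [||c /set_mem[Ac _] cmin] := @compact_EVT_min E R (fun y => `|x - y|) B _ (cA _ _).
- by exists a.
- apply: continuous_subspaceT => y; apply: cvg_norm; apply: cvgB => //.
  exact: cvg_cst.
exists c => // y Ay; have [xy|xy] := leP `|x - y| `|x - a|.
  by apply: cmin; rewrite inE; split.
by apply: le_trans (ltW xy); apply: cmin; rewrite inE.
Qed.

Lemma nearest_point_dot (A : set E) (x p : E) : convex_set A -> A p ->
    (forall y, A y -> `|x - p| <= `|x - y|) ->
  forall y, A y -> ip (y - p) (x - p) <= 0.
Proof.
move=> cA Ap pmin y Ay; rewrite leNgt; apply/negP => d0.
set d := ip _ _ in d0; set q := `|y - p| ^+ 2.
have q0 : 0 <= q by rewrite exprn_ge0.
have dq0 : 0 < d + q by rewrite ltr_pwDl.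
(* Moving from [p] towards [y] by a fraction [l] changes the squared distance to [x] by
   [l (l q - 2 d)]. This [l] stays in []0, 1]] and satisfies [l q < 2 d], contradicting
   minimality. *)
set l := d / (d + q).
have l0 : 0 < l by rewrite divr_gt0.
have l1 : l <= 1 by rewrite ler_pdivrMr// mul1r lerDl.
have /set_mem Al : (conv (Itv01 (ltW l0) l1) (y : convex_lmodType E) p) \in A.
  by apply: cA; rewrite inE.
have := pmin _ Al.
have -> : x - conv (Itv01 (ltW l0) l1) (y : convex_lmodType E) p =
    (x - p) - l *: (y - p).
  rewrite /conv/= scalerBl scale1r scalerBr -addrA -opprD; congr (x - _).
  by rewrite addrCA.
rewrite -(@ler_pXn2r _ 2) ?nnegrE//.
rewrite (normB_sqr (x - p)) normrZ gtr0_norm// exprMn -/q dotZr dot_sym -/d => h.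
have {h} : 2 * d <= l * q.
  suff : l * (2 * d) <= l * (l * q) by rewrite ler_pM2l.
  by move: h; lra.
rewrite /l mulrAC ler_pdivlMr// => h.
have : d * (d + q) <= 0 by nra.
by rewrite leNgt mulr_gt0.
Qed.

End Hilbert.

(** * The catching-up algorithm on finite grids and its limit *)

Section CatchingUp.
Context {R : realType} {E : normedModType R} (ip : {dot E for (@idfun R)}).
Hypothesis ip_norm : norm_from_dot ip.
Variables (T : R) (rho : R -> R) (K : R) (D : R -> set E).
Hypothesis K_ge0 : 0 <= K.
Hypothesis rho_nd : {in `[0, T] &, {homo rho : s t / s <= t}}.
Hypothesis D_neq0 : forall t, 0 <= t <= T -> D t !=set0.
Hypothesis D_convex : forall t, 0 <= t <= T -> convex_set (D t).
Hypothesis D_compact : forall t, 0 <= t <= T -> ball_compact (D t).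
Hypothesis D_lip : forall s t x, 0 <= s <= T -> 0 <= t <= T -> D s x ->
  exists2 y, D t y & `|x - y| <= K * `|rho t - rho s|.

Definition catch_step (W : R -> E) : rel R := fun s t =>
  `[< [/\ s < t, D t (W t) & forall y, D t y -> `|W s - W t| <= `|W s - y|] >].

(** Recursion on the tail: the selection built from the next grid point on is overwritten by [x] up
    to [a], which no later grid point notices. *)
Lemma catch_step_exists l a x : path <%R a l ->
    all (fun t => 0 <= t <= T) l ->
  exists2 W, W a = x & path (catch_step W) a l.
Proof.
elim: l a x => [|b l IH] a x /=; first by exists (fun=> x).
move=> /andP[ab abl] /andP[bT lT].
have [p Dp pmin] := nearest_point x (D_neq0 bT) (D_compact bT).
have [W Wb Wl] := IH b p abl lT.
exists (fun t => if t <= a then x else W t); first by rewrite lexx.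
apply/andP; split.
  by apply/asboolP; rewrite lexx leNgt ab/= Wb; split.
rewrite (@eq_in_path _ [pred t | a < t] _ (catch_step W)) //.
  by move=> s t; rewrite !inE /catch_step => sa ta; rewrite !leNgt sa ta.
rewrite /= ab; apply/allP => t tl; rewrite inE.
by apply: (lt_trans ab); move: (order_path_min lt_trans abl) => /allP; exact.
Qed.

Section OneGrid.
Variables (W : R -> E) (l : seq R).
Hypothesis Wl : path (catch_step W) 0 l.
Hypothesis lT : all (fun t => 0 <= t <= T) (0 :: l).
Hypothesis D0 : D 0 (W 0).

Lemma catch_step_lt : path <%R 0 l.
Proof. by apply: sub_path Wl => s t /asboolP[]. Qed.

Lemma grid_in t : t \in 0 :: l -> 0 <= t <= T.
Proof. by move/(allP lT). Qed.

(** Induction along the grid started at an arbitrary grid point, phrased with times instead of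
    indices; the grid is peeled from its last point. *)
Lemma grid_ind (P : R -> Prop) s : s \in 0 :: l -> P s ->
    (forall t u, t \in 0 :: l -> u \in 0 :: l -> s <= t -> catch_step W t u ->
       P t -> P u) ->
  forall t, t \in 0 :: l -> s <= t -> P t.
Proof.
move: catch_step_lt Wl; clear.
elim/last_ind: l => [|l' x IH].
  by move=> _ _; rewrite !inE => /eqP-> Ps _ t; rewrite inE => /eqP->.
rewrite !rcons_path => /andP[lt_l ltx] /andP[cl cx] sl Ps step t tl st.
have inl u : u \in 0 :: rcons l' x -> (u \in 0 :: l') || (u == x).
  by rewrite !inE mem_rcons inE; case: (u == 0) => //=; rewrite orbC.
have subl u : u \in 0 :: l' -> u \in 0 :: rcons l' x.
  by rewrite !inE mem_rcons inE => /orP[->//|->]; rewrite !orbT.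
have xl : x \in 0 :: rcons l' x by rewrite inE mem_rcons inE eqxx orbT.
have lelast u : u \in 0 :: l' -> u <= last 0 l'.
  move=> ul; have : sorted <=%R (0 :: l').
    by apply: sub_path lt_l => ? ? /ltW.
  move=> /(sorted_leq_nth le_trans lexx 0) h.
  rewrite -(nth_index 0 ul) -[last 0 l']/(last 0 (0 :: l')) -nth_last.
  have ui : (index u (0%R :: l') < size (0%R :: l'))%N by rewrite index_mem.
  by apply: h; rewrite ?inE.
have stepl t' u : t' \in 0 :: l' -> u \in 0 :: l' -> s <= t' ->
    catch_step W t' u -> P t' -> P u.
  by move=> t'l ul; apply: step; exact: subl.
have /orP[sl'|/eqP sx] := inl _ sl; last first.
  have /orP[tl'|/eqP->] := inl _ tl; last by rewrite -sx.
  move: st; rewrite sx leNgt => /negP; case.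
  exact: le_lt_trans (lelast _ tl') ltx.
have /orP[tl'|/eqP->] := inl _ tl; first exact: IH.
apply: (step (last 0 l')) => //.
- by apply: subl; exact: mem_last.
- exact: lelast.
- by apply: IH => //; [exact: mem_last|exact: lelast].
Qed.

Lemma grid_mem t : t \in 0 :: l -> D t (W t).
Proof.
move=> tl; apply: (@grid_ind (fun t => D t (W t)) 0) => //.
- exact: mem_head.
- by move=> s u _ _ _ /asboolP[].
- by have /andP[] := grid_in tl.
Qed.

Lemma grid_rho s t : s \in 0 :: l -> t \in 0 :: l -> s <= t -> rho s <= rho t.
Proof. by move=> /grid_in sT /grid_in tT st; apply: rho_nd; rewrite ?in_itv. Qed.

(** [D_lip] moves [W s] to some point of [D t], and the projection [W t] is at least as close. *)
Lemma grid_step_lip s t : s \in 0 :: l -> t \in 0 :: l -> catch_step W s t ->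
  `|W t - W s| <= K * (rho t - rho s).
Proof.
move=> sl tl /asboolP[st _ Wmin].
have [y Dy yle] := D_lip (grid_in sl) (grid_in tl) (grid_mem sl).
rewrite distrC (le_trans (Wmin _ Dy))// (le_trans yle)// ger0_norm//.
by rewrite subr_ge0 grid_rho// ltW.
Qed.

Lemma grid_lip s t : s \in 0 :: l -> t \in 0 :: l -> s <= t ->
  `|W t - W s| <= K * (rho t - rho s).
Proof.
move=> sl; move: t; apply: grid_ind => //.
  by rewrite (subrr (rho s)) (subrr (W s)) normr0 mulr0.
move=> t u tl ul st tu IH.
have := grid_step_lip tl ul tu; have := ler_distD (W t) (W u) (W s).
by move: IH; lra.
Qed.

(** The projection inequalities are summed step by step. At a step landing on [u], [y] is replaced
    by a point of [D u] and [z] by [W u]; each replacement costs [m] times the length of the step,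
    hence the factor [2 m K]. *)
Lemma grid_piece y z m s e : s \in 0 :: l -> e \in 0 :: l -> s <= e -> 0 <= m ->
    (forall u, u \in 0 :: l -> s <= u -> u <= e ->
       `|W u - z| <= m /\ exists2 y', D u y' & `|y - y'| <= m) ->
  - (2 * m * K * (rho e - rho s)) <= ip (y - z) (W e - W s).
Proof.
move=> sl el se m0 near.
suff: e <= e -> - (2 * m * K * (rho e - rho s)) <= ip (y - z) (W e - W s).
  exact.
apply: (@grid_ind (fun u => u <= e ->
  - (2 * m * K * (rho u - rho s)) <= ip (y - z) (W u - W s)) s) => //.
  by move=> _; rewrite (subrr (rho s)) (subrr (W s)) mulr0 oppr0 linear0r.
move=> t u tl ul st tu IH ue.
have [tu_lt Du Wmin] := asboolP _ tu.
have := IH (ltW (lt_le_trans tu_lt ue)).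
have su : s <= u := le_trans st (ltW tu_lt).
have [Wz [y' Dy' yy']] := near u ul su ue.
have vi := nearest_point_dot ip_norm (D_convex (grid_in ul)) Du Wmin Dy'.
have lip := grid_step_lip tl ul tu.
have : - (m * (K * (rho u - rho t))) <= ip (y - y') (W u - W t).
  apply: le_trans (dot_lerN ip_norm _ _); rewrite lerN2.
  by apply: ler_pM.
have : - (m * (K * (rho u - rho t))) <= ip (W u - z) (W u - W t).
  apply: le_trans (dot_lerN ip_norm _ _); rewrite lerN2.
  by apply: ler_pM.
have -> : W u - W s = (W u - W t) + (W t - W s) by rewrite addrA subrK.
(* [y - z] is split as [(y - y') + (y' - W u) + (W u - z)]; the middle term has the right sign by
   [vi]. *)
have -> : ip (y - z) (W u - W t + (W t - W s)) = ip (y - y') (W u - W t) +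
   ip (W u - z) (W u - W t) - ip (y' - W u) (W t - W u) + ip (y - z) (W t - W s).
  by rewrite !(dotDl, dotDr, dotNl, dotNr); ring.
move: vi; lra.
Qed.

Lemma grid_pred s t : s \in 0 :: l -> t \in 0 :: l -> s < t ->
  exists2 u, u \in 0 :: l & s <= u /\ catch_step W u t.
Proof.
move=> sl tl st.
apply: (@grid_ind (fun t => s < t ->
  exists2 u, u \in 0 :: l & s <= u /\ catch_step W u t) s) => //.
- by rewrite ltxx.
- by move=> u v ul vl su uv _ _; exists u.
- exact: ltW.
Qed.

(* The step that lands on [t] satisfies the projection inequality exactly; every
   other step costs at most its mass times the total mass of the interval, so
   the error [e] leaves out a possible atom at [t]. *)
Lemma grid_vi y a t b e : a \in 0 :: l -> t \in 0 :: l -> b \in 0 :: l ->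
    a < t -> t <= b -> D t y ->
    (forall s, a <= s -> s < t -> rho s - rho a + (rho b - rho t) <= e) ->
  - (2 * K ^+ 2 * (rho b - rho a) * e) <= ip (y - W t) (W b - W a).
Proof.
move=> al tl bl at_ tb Dy le_e.
have [s sl [as_ st]] := grid_pred al tl at_.
have [st_lt Dt Wmin] := asboolP _ st.
have ab : a <= b := le_trans (ltW at_) tb.
have rab := grid_rho al bl ab.
(* [m] bounds both the distance from [W] to [W t] and the distance from [y] to the sets at all grid
   points of [[a, b]]. *)
set m := K * (rho b - rho a).
have m0 : 0 <= m by rewrite mulr_ge0// subr_ge0.
have near u : u \in 0 :: l -> a <= u -> u <= b ->
    `|W u - W t| <= m /\ exists2 y', D u y' & `|y - y'| <= m.
  move=> ul au ub.
  have rau := grid_rho al ul au; have rub := grid_rho ul bl ub.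
  have rat := grid_rho al tl (ltW at_); have rtb := grid_rho tl bl tb.
  have rut : `|rho u - rho t| <= rho b - rho a by rewrite ler_norml; lra.
  split; last first.
    have [y' Dy' yy'] := D_lip (grid_in tl) (grid_in ul) Dy.
    by exists y' => //; rewrite (le_trans yy')// ler_wpM2l.
  apply: (@le_trans _ _ (K * `|rho u - rho t|)); last by rewrite ler_wpM2l.
  have [ut|/ltW tu] := leP u t.
    by rewrite distrC (le_trans (grid_lip ul tl ut))// ler_wpM2l// distrC ler_norm.
  by rewrite (le_trans (grid_lip tl ul tu))// ler_wpM2l// ler_norm.
have h1 : - (2 * m * K * (rho s - rho a)) <= ip (y - W t) (W s - W a).
  apply: grid_piece => // u ul au us; apply: near => //.
  exact: le_trans us (le_trans (ltW st_lt) tb).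
have h2 : - (2 * m * K * (rho b - rho t)) <= ip (y - W t) (W b - W t).
  apply: grid_piece => // u ul tu ub; apply: near => //.
  exact: le_trans (ltW at_) tu.
have h3 := nearest_point_dot ip_norm (D_convex (grid_in tl)) Dt Wmin Dy.
have h4 : 2 * m * K * (rho s - rho a + (rho b - rho t)) <= 2 * m * K * e.
  apply: ler_wpM2l; last exact: le_e.
  by do 2?apply: mulr_ge0 => //.
have -> : ip (y - W t) (W b - W a) = ip (y - W t) (W b - W t) -
    ip (y - W t) (W s - W t) + ip (y - W t) (W s - W a).
  by rewrite !(dotDl, dotDr, dotNl, dotNr); ring.
have -> : 2 * K ^+ 2 * (rho b - rho a) * e = 2 * m * K * e by rewrite /m; ring.
move: h1 h2 h3 h4; lra.
Qed.

End OneGrid.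

Lemma catching_up_limit (w0 : E) : 0 <= T -> D 0 w0 -> exists w : R -> E,
  [/\ w 0 = w0,
      forall t, 0 <= t <= T -> D t (w t),
      forall s t, 0 <= s -> s <= t -> t <= T ->
        `|w t - w s| <= K * (rho t - rho s) &
      forall y a t b e, 0 <= a -> a < t -> t <= b -> b <= T -> D t y ->
        (forall s, a <= s -> s < t -> rho s - rho a + (rho b - rho t) <= e) ->
        - (2 * K ^+ 2 * (rho b - rho a) * e) <= ip (y - w t) (w b - w a)].
Proof.
move=> T0 Dw0.
(* Any finite list is turned into a grid, so that the index set is directed by mere inclusion of
   lists; [0] is put in front separately. *)
pose grid P := sort <=%R (undup [seq s <- P | (0 < s) && (s <= T)]).
have grid_mem0 P t : (t \in 0 :: grid P) = (t == 0) || (t \in P) && (0 < t <= T).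
  by rewrite inE mem_sort mem_undup mem_filter andbC.
have grid_all P : all (fun t => 0 <= t <= T) (0 :: grid P).
  apply/allP => t; rewrite grid_mem0 => /orP[/eqP->|/andP[_ /andP[/ltW->->]]]//.
  by rewrite lexx.
have grid_path P : path <%R 0 (grid P).
  rewrite (path_sortedE lt_trans); apply/andP; split.
    by apply/allP => t; rewrite mem_sort mem_undup mem_filter => /andP[/andP[]].
  by rewrite sort_lt_sorted undup_uniq.
have /choice[W HW] (P : seq R) : exists W, W 0 = w0 /\ path (catch_step W) 0 (grid P).
  have [|W W0 Wl] := @catch_step_exists (grid P) 0 w0 (grid_path P).
    by have /andP[] := grid_all P.
  by exists W.
have WD0 P : D 0 (W P 0) by rewrite (HW P).1.
(* Along an ultrafilter of finite grids ordered by inclusion, ball-compactness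
   makes the discrete solutions converge at all times simultaneously, without
   any Cauchy estimate. *)
pose F := filter_from [set: seq R] (fun Q => [set P : seq R | {subset Q <= P}]).
have FF : ProperFilter F.
  apply: filter_from_proper; last by move=> Q _; exists Q => ?.
  apply: filter_from_filter; first by exists [::].
  move=> Q Q' _ _; exists (Q ++ Q') => // P /= QP.
  by split => t tQ; apply: QP; rewrite mem_cat tQ ?orbT.
have [G [GU FG]] := ultraFilterLemma FF.
have GP : ProperFilter G by exact: ultra_proper.
(* Every fixed time belongs to the grid eventually, so estimates at grid points pass to the limit at
   arbitrary times. *)
have near_grid t : 0 <= t <= T -> \forall P \near G, t \in 0 :: grid P.
  move=> /andP[t0 tT]; apply: FG; exists [:: t] => // P /= tP.
  by rewrite grid_mem0 tT andbT tP ?mem_head//= eq_sym -le_eqVlt.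
have W0 P : W P 0 = w0 by exact: (HW P).1.
have lim_ex t : exists x, 0 <= t <= T -> D t x /\ W P t @[P --> G] --> x.
  have [tT|] := boolP (0 <= t <= T); last by exists w0.
  (* By [grid_lip] all discrete values at [t] lie within [c] of [w0]: this is the ball on which
     ball-compactness is used. *)
  pose c := K * (rho t - rho 0).
  have [|x [[Dx _] clx]] :=
      @D_compact t tT w0 c ((fun P => W P t) @ G).
  - change (\forall P \near G, (D t `&` closed_ball_ Num.norm w0 c) (W P t)).
    near=> P.
    have tl : t \in 0 :: grid P by near: P; exact: near_grid.
    split; first exact: (grid_mem (HW P).2).
    rewrite /closed_ball_/= distrC -(W0 P).
    by apply: (grid_lip (HW P).2) => //; [exact: mem_head|have /andP[] := tT].
  (* A cluster point of an ultrafilter is a limit: otherwise the complement of [N] would belong to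
     [G] and would have to meet [N]. *)
  exists x => _; split => // N Nx.
  have [//|GN] := @in_ultra_setVsetC _ G ((fun P => W P t) @^-1` N) GU.
  by have [z []] := clx (~` N) N GN Nx.
have {lim_ex} /choice[w Hw] := lim_ex.
have cvgw t : 0 <= t -> t <= T -> W P t @[P --> G] --> w t.
  by move=> t0 tT; have [] := Hw t; rewrite ?t0.
exists w; split.
- have := cvgw 0 (lexx 0) T0; under eq_fun do rewrite W0.
  by move=> h; apply: (cvg_unique _ h (cvg_cst _)).
- by move=> t tT; have [] := Hw t tT.
- move=> s t s0 st tT.
  have sT : s <= T := le_trans st tT; have t0 : 0 <= t := le_trans s0 st.
  apply: (@cvgr_to_le _ G _ _ (fun P => `|W P t - W P s|)).
    by apply: cvg_norm; apply: cvgB; exact: cvgw.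
  near=> P; apply: (grid_lip (HW P).2) => //; near: P; apply: near_grid.
    by rewrite s0.
  by rewrite t0.
- move=> y a t b e a0 at_ tb bT Dy le_e.
  have tT : t <= T := le_trans tb bT; have t0 : 0 <= t := le_trans a0 (ltW at_).
  have b0 : 0 <= b := le_trans t0 tb; have aT : a <= T := le_trans (ltW at_) tT.
  apply: (@cvgr_to_ge _ G _ _ (fun P => ip (y - W P t) (W P b - W P a))).
    apply: (cvg_dot ip_norm); apply: cvgB; try exact: cvgw.
    exact: cvg_cst.
  near=> P; apply: (grid_vi (HW P).2) => //; near: P; apply: near_grid.
  + by rewrite a0.
  + by rewrite t0.
  + by rewrite b0.
Unshelve. all: by end_near. Qed.

End CatchingUp.

(** * Lower integrals and simple functions *)

Section LowerIntegral.
Local Open Scope ereal_scope.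
Context d (X : measurableType d) {R : realType}.
Variable mu : {measure set X -> \bar R}.

(* [f2] need not be measurable: its integral is then a lower integral. This is
   needed because [is_bochner_integral] only controls a density up to a null
   set of a measure that is not complete. *)
Lemma ae_le_integral_nonmeas (D : set X) (f1 f2 : X -> \bar R) :
    measurable D -> measurable_fun D f1 ->
    (forall x, D x -> 0 <= f1 x) -> (forall x, D x -> 0 <= f2 x) ->
    {ae mu, forall x, D x -> f1 x <= f2 x} ->
  \int[mu]_(x in D) f1 x <= \int[mu]_(x in D) f2 x.
Proof.
move=> mD mf1 f10 f20 [N [mN N0 DN]].

(* Only the measurable [f1] is cut down to the complement of [N]. Each simple function below the
   result is then below [f2] on all of [D], so the suprema compare. *)
rewrite (ge0_negligible_integral mN mD mf1 f10 N0).
rewrite [leLHS]ge0_integralE; last by move=> x [/f10].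
rewrite [leRHS]ge0_integralE//.
apply: ub_ereal_sup => _ [h hf <-].
apply: ereal_sup_ubound; exists h => // x.
apply: (le_trans (hf x)); rewrite /patch.
case: ifPn => [/set_mem[Dx Nx]|]; last first.
  by move=> _; case: ifPn => // /set_mem /f20.
rewrite mem_set//; apply: contrapT => /negP xf; apply: Nx; apply: DN => /=.
by move/(_ Dx); exact/negP.
Qed.

End LowerIntegral.

Section SimpleFunctions.
Context d (X : measurableType d) {R : realType}.

Lemma simple_fun_preimage (E : normedModType R) (s : X -> E) (A : set E) :
  simple_fun s -> measurable (s @^-1` A).
Proof.
move=> [fs ms].
have -> : s @^-1` A = \bigcup_(y in range s `&` A) (s @^-1` [set y]).
  apply/seteqP; split => x /=; first by move=> As; exists (s x).
  by move=> [y [_ Ay] /= ->].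
apply: fin_bigcup_measurable => //; exact: sub_finite_set fs.
Qed.

Lemma simple_fun2 (E1 E2 E3 : normedModType R) (phi : E1 -> E2 -> E3)
    (s1 : X -> E1) (s2 : X -> E2) :
  simple_fun s1 -> simple_fun s2 -> simple_fun (fun x => phi (s1 x) (s2 x)).
Proof.
move=> h1 h2; split.
  apply: (@sub_finite_set _ _
      [set phi u.1 u.2 | u in range s1 `*` range s2]).
    by move=> _ [x _ <-]; exists (s1 x, s2 x) => //=; split; exists x.
  by apply: finite_image; apply: finite_setX; [exact: h1.1|exact: h2.1].
move=> y.
have -> : (fun x => phi (s1 x) (s2 x)) @^-1` [set y] =
    \bigcup_(a in range s1)
      (s1 @^-1` [set a] `&` s2 @^-1` [set b | phi a b = y]).
  apply/seteqP; split => x /=; first by move=> <-; exists (s1 x) => //=; exists x.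
  by move=> [_ _ [/= -> ->]].
apply: fin_bigcup_measurable => [|a _]; first exact: h1.1.
by apply: measurableI; exact: simple_fun_preimage.
Qed.

Lemma simple_fun_restrict (E : normedModType R) (s : X -> E) (A : set X) :
    measurable A -> simple_fun s ->
  simple_fun (fun x => if x \in A then s x else 0).
Proof.
move=> mA hs; split.
  apply: (@sub_finite_set _ _ (0 |` range s)).
    by move=> _ [x _ <-]; case: ifPn => _; [right; exists x|left].
  by rewrite finite_setU; split; [exact: finite_set1|exact: hs.1].
move=> y.
have -> : (fun x => if x \in A then s x else 0) @^-1` [set y] =
    (A `&` s @^-1` [set y]) `|` (~` A `&` [set x | 0 = y]).
  apply/seteqP; split => x /=.
    by case: ifPn => [/set_mem Ax e|/negP Ax e]; [left|right; split => // /mem_set].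
  by move=> [[/mem_set->]//|[Ax <-]]; rewrite memNset.
apply: measurableU; first by apply: measurableI => //; exact: hs.2.
apply: measurableI; first exact: measurableC.
have [->|y0] := eqVneq y 0.
  by rewrite (_ : [set x | _] = setT)//; apply/seteqP; split.
rewrite (_ : [set x | _] = set0)//; apply/seteqP; split => // x /= y0'.
by rewrite -y0' eqxx in y0.
Qed.

(** [phi] may be arbitrary, because a simple function pulls every set back to a measurable one. *)
Lemma simple_fun_measurable (E : normedModType R) (s : X -> E) (phi : E -> R) :
  simple_fun s -> measurable_fun setT (fun x => phi (s x)).
Proof.
move=> hs _ B mB; rewrite setTI.
exact: (@simple_fun_preimage _ s (phi @^-1` B)).
Qed.

Lemma simple_fun_bounded (E : normedModType R) (s : X -> E) : simple_fun s ->
  exists2 M, 0 <= M & forall x, `|s x| <= M.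
Proof.
move=> [fs _]; pose l := finmap.enum_fset (fset_set (range s)).
exists (\big[Num.max/0]_(y <- l) `|y|).
  by elim/big_ind: _ => // a b a0 b0; rewrite le_max a0.
move=> x; apply: le_bigmax_seq => //.
by rewrite /l in_fset_set// inE; exists x.
Qed.

End SimpleFunctions.

(** * Bochner integrals through scalar pairings *)

Section Bochner.
Context d (X : measurableType d) {R : realType} {E : completeNormedModType R}.
Variables (ip : {dot E for (@idfun R)}).
Hypothesis ip_norm : norm_from_dot ip.
Variable mu : {finite_measure set X -> \bar R}.

(** Convergence holds at every point and one bound serves all terms, so that the real functions
    derived from [g] are measurable for [mu] itself, not just for its completion, and dominated
    convergence applies. *)
Definition bounded_limit (M : R) (g : X -> E) : Prop :=
  exists s_ : nat -> X -> E,
    [/\ forall n, simple_fun (s_ n), forall n x, `|s_ n x| <= M &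
        forall x, s_ n x @[n --> \oo] --> g x].

Lemma bounded_limit_simple s M : simple_fun s -> (forall x, `|s x| <= M) ->
  bounded_limit M s.
Proof. by move=> hs sM; exists (fun=> s); split => // x; exact: cvg_cst. Qed.

Lemma bounded_limit_le M g x : bounded_limit M g -> `|g x| <= M.
Proof.
move=> [s [_ sM sg]].
apply: (@cvgr_to_le _ \oo _ _ (fun n => `|s n x|)); first exact: cvg_norm.
by near=> n; exact: sM.
Unshelve. all: by end_near. Qed.

Lemma bounded_limitB M M' g g' : bounded_limit M g -> bounded_limit M' g' ->
  bounded_limit (M + M') (fun x => g x - g' x).
Proof.
move=> [s [hs sM sg]] [s' [hs' sM' sg']]; exists (fun n x => s n x - s' n x).
split=> [n|n x|x]; first exact: (@simple_fun2 _ _ _ E E E (fun a b => a - b)).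
  by rewrite (le_trans (ler_normB _ _))// lerD.
exact: cvgB.
Qed.

Lemma bounded_limit_norm_measurable M g s : bounded_limit M g -> simple_fun s ->
  measurable_fun setT (fun x => `|g x - s x|).
Proof.
move=> [s_ [hs _ sg]] h.
apply: (@measurable_realfun.measurable_fun_cvg _ _ _ _ (fun n x => `|s_ n x - s x|)).
  move=> n; apply: (@simple_fun_measurable _ _ _ E (fun x => s_ n x - s x)).
  exact: (@simple_fun2 _ _ _ E E E (fun a b => a - b)).
by move=> x _; apply: cvg_norm; apply: cvgB => //; exact: cvg_cst.
Qed.

Lemma bounded_limit_dot_measurable M g z : bounded_limit M g ->
  measurable_fun setT (fun x => ip (g x) z).
Proof.
move=> [s_ [hs _ sg]].
apply: (@measurable_realfun.measurable_fun_cvg _ _ _ _ (fun n x => ip (s_ n x) z)).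
  by move=> n; apply: (@simple_fun_measurable _ _ _ E (s_ n) (fun a => ip a z)).
by move=> x _; apply: (cvg_dot ip_norm) => //; exact: cvg_cst.
Qed.

Lemma bounded_integrable (D : set X) (f : X -> R) (M : R) : measurable D ->
    measurable_fun setT f -> (forall x, `|f x| <= M) ->
  mu.-integrable D (EFin \o f).
Proof.
move=> mD mf fM; apply: measurable_bounded_integrable => //.
- by rewrite ltey_eq fin_num_measure.
- exact: measurable_funTS.
- exists M; split; first exact: num_real.
  by move=> x Mx y _ /=; rewrite (le_trans (fM y))// ltW.
Qed.

Lemma bounded_limit_dot_integrable (D : set X) M g z : measurable D ->
  bounded_limit M g -> mu.-integrable D (EFin \o (fun x => ip (g x) z)).
Proof.
move=> mD hg; apply: (@bounded_integrable _ _ (M * `|z|)) => //.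
  exact: bounded_limit_dot_measurable hg.
move=> x; rewrite (le_trans (cauchy_schwarz ip_norm _ _))// ler_wpM2r//.
exact: bounded_limit_le.
Qed.

Lemma bounded_limit_norm_integrable (D : set X) M g s : measurable D ->
    bounded_limit M g -> simple_fun s ->
  mu.-integrable D (EFin \o (fun x => `|g x - s x|)).
Proof.
move=> mD hg hs; have [M' _ sM'] := simple_fun_bounded hs.
apply: (@bounded_integrable _ _ (M + M')) => //.
  exact: bounded_limit_norm_measurable hg hs.
move=> x; rewrite normr_id (le_trans (ler_normB _ _))// lerD//.
exact: bounded_limit_le.
Qed.

Lemma dot_simple_integral (D : set X) (s : X -> E) z : measurable D ->
    simple_fun s ->
  ip (simple_integral mu D s) z = \int[mu]_(x in D) ip (s x) z.
Proof.
move=> mD hs; rewrite /simple_integral fsbig_finite /=; last exact: hs.1.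
set l := finmap.enum_fset _.
have ul : uniq l by exact: finmap.fset_uniq.
have sl x : s x \in l by rewrite /l in_fset_set ?inE; [exists x|exact: hs.1].
have -> : (fun x => ip (s x) z) =
    (fun x => \sum_(y <- l) ip y z * \1_(s @^-1` [set y]) x).
  apply/funext => x; rewrite (bigD1_seq (s x))//= indicE mem_set// mulr1.
  rewrite big1 ?addr0// => y yx; rewrite indicE memNset ?mulr0//=.
  by move=> xy; rewrite xy eqxx in yx.
have mi y : measurable_fun setT (\1_(s @^-1` [set y]) : X -> R).
  by apply: measurable_indic; exact: hs.2.
have iy y : mu.-integrable D (EFin \o (\1_(s @^-1` [set y]) : X -> R)).
  apply: (@bounded_integrable _ _ 1) => // x.
  by rewrite indicE; case: (_ \in _); rewrite ?normr1 ?normr0.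
(* The facts tying [l] to the range of [s] are dropped: the remaining identity is linear and holds
   for any list of values. *)
elim: l {ul sl} => [|y l IH].
  rewrite big_nil linear0l; under eq_Rintegral do rewrite big_nil.
  by rewrite Rintegral_cst// mul0r.
rewrite big_cons dotDl dotZl IH.
under [RHS]eq_Rintegral do rewrite big_cons.
have isum : mu.-integrable D
    (EFin \o (fun x => \sum_(j <- l) ip j z * \1_(s @^-1` [set j]) x)).
  apply: eq_integrable (integrable_sum mD l
    (h := fun j x => ((ip j z)%:E * (\1_(s @^-1` [set j]) x)%:E)%E) _) => //.
    by move=> x _ /=; rewrite -sumEFin.
  by move=> j _; apply: integrableZl => //; exact: iy.
have iyz : mu.-integrable D (EFin \o (fun x => ip y z * \1_(s @^-1` [set y]) x)).
  by apply: (@integrableZl _ _ _ _ _ mD (ip y z) _ (iy y)).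
rewrite RintegralD// RintegralZl//; congr (_ + _).
rewrite mulrC; congr (_ * _).
rewrite /Rintegral integral_indic//; last exact: hs.2.
by rewrite setIC.
Qed.

End Bochner.

Lemma cvg_dist_bound (R : realType) (V : normedModType R) (f : nat -> V) (l : V)
    (e : nat -> R) :
  (forall n, `|f n - l| <= e n) -> e n @[n --> \oo] --> 0 ->
  f n @[n --> \oo] --> l.
Proof.
move=> fe e0; apply/cvgrPdistC_le => eps eps0; near=> n.
apply: (le_trans (fe n)); near: n.
by apply: (cvgr_le 0).
Unshelve. all: by end_near. Qed.

Section BochnerIntegral.
Context d (X : measurableType d) {R : realType} {E : completeNormedModType R}.
Variables (ip : {dot E for (@idfun R)}).
Hypothesis ip_norm : norm_from_dot ip.
Variable mu : {finite_measure set X -> \bar R}.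

Lemma dot_simple_integralB (D : set X) M (g s : X -> E) z : measurable D ->
    bounded_limit M g -> simple_fun s ->
  `|ip (simple_integral mu D s) z - \int[mu]_(x in D) ip (g x) z| <=
    (\int[mu]_(x in D) `|g x - s x|) * `|z|.
Proof.
move=> mD hg hs; rewrite (dot_simple_integral ip mu z mD hs).
have [M' _ sM'] := simple_fun_bounded hs.
have hs' := bounded_limit_simple hs sM'.
have ig := bounded_limit_dot_integrable ip_norm mu z mD hg.
have is_ := bounded_limit_dot_integrable ip_norm mu z mD hs'.
have igs := bounded_limit_norm_integrable mu mD hg hs.
have igs' : mu.-integrable D (EFin \o (fun x => ip (s x) z - ip (g x) z)).
  exact: (integrableB mD is_ ig).
rewrite -RintegralB//; apply: (le_trans (le_normr_Rintegral mD igs')).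
rewrite mulrC -RintegralZl//; apply: le_Rintegral => //.
- exact: (integrable_norm igs').
- exact: (integrableZl mD `|z| igs).
- move=> x _; rewrite -dotNl -dotDl mulrC distrC.
  exact: cauchy_schwarz.
Qed.

Lemma bounded_limit_cvg_L1 (D : set X) M (g : X -> E) (s_ : nat -> X -> E) :
    measurable D -> (forall n, simple_fun (s_ n)) ->
    (forall n x, `|s_ n x| <= M) -> (forall x, s_ n x @[n --> \oo] --> g x) ->
  (\int[mu]_(x in D) `|g x - s_ n x|%:E)%E @[n --> \oo] --> 0%E.
Proof.
move=> mD hs sM sg.
have hg : bounded_limit M g by exists s_.
have -> : 0%E = (\int[mu]_(x in D) (cst 0) x)%E by rewrite integral0.
apply: (@dominated_cvg _ _ _ mu D mD
  (fun n x => `|g x - s_ n x|%:E) (cst 0%E) (cst (M + M)%:E)).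
- move=> n; apply/measurable_EFinP/measurable_funTS.
  exact: bounded_limit_norm_measurable hg (hs n).
- move=> x _; apply: cvg_EFin; first by near=> n.
  rewrite /= -(normr0 E); apply: cvg_norm.
  by rewrite -(subrr (g x)); apply: cvgB => //; exact: cvg_cst.
- by [].
- exact: finite_measure_integrable_cst.
- move=> n x _ /=; rewrite lee_fin normr_id (le_trans (ler_normB _ _))// lerD//.
  exact: bounded_limit_le hg.
Unshelve. all: by end_near. Qed.

Lemma bounded_limit_fine_integral (D : set X) M (g s : X -> E) : measurable D ->
    bounded_limit M g -> simple_fun s ->
  (\int[mu]_(x in D) `|g x - s x|%:E)%E =
    (\int[mu]_(x in D) `|g x - s x|)%:E.
Proof.
move=> mD hg hs; rewrite /Rintegral fineK//.
by apply: integrable_fin_num => //; exact: bounded_limit_norm_integrable hg hs.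
Qed.

(** Tested against [z], two simple integrals differ by at most the sum of their L1 errors times
    [|z|], so they form a Cauchy sequence. The pairings identify the limit, which therefore does not
    depend on the approximating sequence. *)
Lemma cvg_simple_integral (D : set X) M (g : X -> E) (s_ : nat -> X -> E) :
    measurable D -> bounded_limit M g -> (forall n, simple_fun (s_ n)) ->
    (\int[mu]_(x in D) `|g x - s_ n x|%:E)%E @[n --> \oo] --> 0%E ->
  exists2 v : E, (forall z, ip v z = \int[mu]_(x in D) ip (g x) z) &
    simple_integral mu D (s_ n) @[n --> \oo] --> v.
Proof.
move=> mD hg hs L1; pose e n := \int[mu]_(x in D) `|g x - s_ n x|.
have e0 : e n @[n --> \oo] --> 0.
  move: L1; under eq_fun do rewrite (bounded_limit_fine_integral mD hg (hs _)).
  by move/fine_cvgP => [_].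
have ege n : 0 <= e n by apply: Rintegral_ge0.
have cauchy : cvgn (fun n => simple_integral mu D (s_ n)).
  apply/cauchy_cvgP/cauchyP => eps eps0 /=.
  have [N _ Ne] : \forall n \near \oo, e n < eps / 2.
    by apply: (cvgr_lt 0) => //; rewrite divr_gt0.
  exists (simple_integral mu D (s_ N)); exists N => // n Nn.
  rewrite -ball_normE /ball_/=.
  apply: (@le_lt_trans _ _ (e N + e n)); last first.
    by rewrite (splitr eps) ltrD// Ne//=.
  apply: (dot_weak_norm ip_norm); first by rewrite addr_ge0.
  move=> z; rewrite dotDl dotNl mulrDl.
  have := dot_simple_integralB z mD hg (hs N).
  have := dot_simple_integralB z mD hg (hs n).
  rewrite -/(e n) -/(e N) !ler_norml; lra.
exists (limn (fun n => simple_integral mu D (s_ n))) => // z.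
have h1 : ip (simple_integral mu D (s_ n)) z @[n --> \oo] -->
    ip (limn (fun n => simple_integral mu D (s_ n))) z.
  by apply: (cvg_dot ip_norm) => //; exact: cvg_cst.
have h2 : ip (simple_integral mu D (s_ n)) z @[n --> \oo] -->
    \int[mu]_(x in D) ip (g x) z.
  apply: (@cvg_dist_bound _ _ _ _ (fun n => e n * `|z|)).
    by move=> n; exact: (dot_simple_integralB z mD hg (hs n)).
  by rewrite -(mul0r `|z|); apply: cvgM => //; exact: cvg_cst.
exact: cvg_unique h1 h2.
Qed.

Lemma bochner_integral_exists (D : set X) M (g : X -> E) : measurable D ->
  bounded_limit M g -> exists v, forall z, ip v z = \int[mu]_(x in D) ip (g x) z.
Proof.
move=> mD hg; have [s [hs sM sg]] := hg.
have [v vz _] := cvg_simple_integral mD hg hs (bounded_limit_cvg_L1 mD hs sM sg).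
by exists v.
Qed.

Lemma is_bochner_integral_weak (D : set X) M (g : X -> E) v : measurable D ->
    bounded_limit M g -> (forall z, ip v z = \int[mu]_(x in D) ip (g x) z) ->
  is_bochner_integral mu D g v.
Proof.
move=> mD hg vz; have [s [hs sM sg]] := hg.
have L1 := bounded_limit_cvg_L1 mD hs sM sg.
have [v' v'z cv'] := cvg_simple_integral mD hg hs L1.
have -> : v = v' by apply: (dot_weak_eq ip_norm) => z; rewrite vz v'z.
by split; exists s; split => //; exact: aeW.
Qed.

(** The approximations given for [g] also approximate [h] in L1; as [g] itself may fail to be
    measurable, this needs the comparison with a lower integral. *)
Lemma is_bochner_integral_dot (D : set X) M (g h : X -> E) v z : measurable D ->
    bounded_limit M h -> {ae mu, forall x, h x = g x} ->
    is_bochner_integral mu D g v ->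
  ip v z = \int[mu]_(x in D) ip (h x) z.
Proof.
move=> mD hh hg [_ [s [hs L1 cv]]].
have L1' : (\int[mu]_(x in D) `|h x - s n x|%:E)%E @[n --> \oo] --> 0%E.
  apply: (squeeze_cvge _ (cvg_cst 0%E) L1); near=> n.
  apply/andP; split; first by apply: integral_ge0 => x _; rewrite lee_fin.
  apply: ae_le_integral_nonmeas => //.
    apply/measurable_EFinP/measurable_funTS.
    exact: bounded_limit_norm_measurable hh (hs n).
  by apply: filterS hg => x -> _.
have [w wz cw] := cvg_simple_integral mD hh hs L1'.
by rewrite -wz; congr (ip _ z); exact: cvg_unique cv cw.
Unshelve. all: by end_near. Qed.

Lemma bounded_limit_ae (M : R) (g : X -> E) : 0 <= M -> strongly_measurable mu g ->
    {ae mu, forall x, `|g x| <= M} ->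
  exists2 h, bounded_limit (M + 1) h & {ae mu, forall x, h x = g x}.
Proof.
move=> M0 [s [hs [N1 [mN1 N10 sN]]]] [N2 [mN2 N20 gN]].
pose A := ~` (N1 `|` N2); pose h x := if x \in A then g x else 0.
have mA : measurable A by apply: measurableC; exact: measurableU.
have notA x : x \in A -> s n x @[n --> \oo] --> g x /\ `|g x| <= M.
  move/set_mem => Ax; split; apply: contrapT => H; apply: Ax.
    by left; exact: sN.
  by right; exact: gN.
exists h; last first.
  exists (N1 `|` N2); split; first exact: measurableU.
    apply: measure_negligible; first exact: measurableU.
    by apply: negligibleU; [exists N1|exists N2]; split.
  move=> x /= hx; apply: contrapT => Ax; apply: hx.
  by rewrite /h mem_set.
(* Truncation at [M + 1] rather than [M]: where the limit has norm at most [M], convergence makes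
   the truncation eventually inactive. *)
pose tr n x := if `|s n x| <= M + 1 then s n x else 0.
have htr n : simple_fun (tr n).
  exact: (@simple_fun2 _ _ _ E E E (fun a _ => if `|a| <= M + 1 then a else 0)).
exists (fun n x => if x \in A then tr n x else 0); split => [n|n x|x].
- exact: simple_fun_restrict.
- rewrite /tr; do 2?case: ifPn => //; rewrite normr0 addr_ge0//.
- rewrite /h; case: ifPn => [/notA[sg gM]|_]; last exact: cvg_cst.
  have sg' := sg; apply: cvg_trans sg'; apply: near_eq_cvg; near=> n.
  rewrite /tr ifT//; near: n.
  apply: (cvgr_norm_le _ sg); rewrite (le_lt_trans gM)// ltrDl//.
Unshelve. all: by end_near. Qed.

End BochnerIntegral.

(** * Dyadic subdivisions of the time interval and step functions *)

Section DyadicGrid.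
Context {R : realType} (T : R).
Hypothesis T_gt0 : 0 < T.

Definition node (n i : nat) : R := T * i%:R / 2 ^+ n.

(* For [0 < t], the index of the half-open dyadic interval containing [t]; the
   value at [t <= 0] is meaningless. *)
Definition cell (n : nat) (t : R) : nat := `|Num.ceil (t * 2 ^+ n / T)|%N.-1.

Lemma node0 n : node n 0 = 0.
Proof. by rewrite /node mulr0n mulr0 mul0r. Qed.

Lemma node_last n : node n (2 ^ n) = T.
Proof. by rewrite /node natrX mulfK// expf_neq0// pnatr_eq0. Qed.

Lemma node_le n i j : (node n i <= node n j) = (i <= j)%N.
Proof.
by rewrite /node ler_pM2r ?invr_gt0 ?exprn_gt0// ler_pM2l// ler_nat.
Qed.

Lemma node_lt n i j : (node n i < node n j) = (i < j)%N.
Proof. by rewrite ltNge node_le -ltnNge. Qed.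

Lemma node_ge0 n i : 0 <= node n i.
Proof. by rewrite -(node0 n) node_le. Qed.

Lemma node_leT n i : (i <= 2 ^ n)%N -> node n i <= T.
Proof. by move=> iN; rewrite -[leRHS](node_last n) node_le. Qed.

Lemma node_in n i : (i <= 2 ^ n)%N -> 0 <= node n i <= T.
Proof. by move=> iN; rewrite node_ge0 node_leT. Qed.

Lemma node_refine n m i : (n <= m)%N -> node m (i * 2 ^ (m - n)) = node n i.
Proof.
move=> nm; rewrite /node natrM natrX -{2}(subnK nm) exprD.
by field; rewrite !expf_neq0// pnatr_eq0.
Qed.

Lemma node_diff n i : node n i.+1 - node n i = T / 2 ^+ n.
Proof. by rewrite /node -mulrBl -mulrBr -natrB// subSnn mulr1. Qed.

Lemma node_ltE n i t : (node n i < t) = (i%:R < t * 2 ^+ n / T).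
Proof. by rewrite /node ltr_pdivrMr ?exprn_gt0// ltr_pdivlMr// mulrC. Qed.

Lemma node_geE n i t : (t <= node n i) = (t * 2 ^+ n / T <= i%:R).
Proof. by rewrite !leNgt node_ltE. Qed.

Lemma cell_itv n t : 0 < t -> node n (cell n t) < t <= node n (cell n t).+1.
Proof.
move=> t0; rewrite node_ltE node_geE /cell; set x := t * 2 ^+ n / T.
have : 0 < Num.ceil x by rewrite ceil_gt0 /x !mulr_gt0 ?invr_gt0 ?exprn_gt0.
have := ceil_itv x; case: (Num.ceil x) => [[//|k]|//].
by rewrite intS addrC addKr.
Qed.

Lemma cell_unique n i t : node n i < t <= node n i.+1 -> cell n t = i.
Proof.
rewrite node_ltE node_geE => it; rewrite /cell (@ceil_def _ _ i.+1)//.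
by rewrite intS addrC addKr -intS.
Qed.

Lemma cell_lt n t : 0 < t -> t <= T -> (cell n t < 2 ^ n)%N.
Proof.
move=> t0 tT; have /andP[ct _] := cell_itv n t0.
by rewrite -(node_lt n) node_last (lt_le_trans ct).
Qed.

Lemma cell_refine n m t : (n <= m)%N -> 0 < t ->
  cell n t = (cell m t %/ 2 ^ (m - n))%N.
Proof.
move=> nm t0; apply: cell_unique; have /andP[ct tc] := cell_itv m t0.
have q0 : (0 < 2 ^ (m - n))%N by rewrite expn_gt0.
rewrite -!(node_refine _ nm); apply/andP; split.
  by apply: le_lt_trans ct; rewrite node_le leq_trunc_div.
by apply: (le_trans tc); rewrite node_le -ltn_divLR.
Qed.

(** The right end of the cell of [t] never lies before [t], so right continuity controls the values
    there; for [t = T] this end is [T] itself. *)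
Lemma right_continuous_node (V : topologicalType) (u : R -> V) t :
    right_continuous_on T u -> 0 < t -> t <= T ->
  u (node n (cell n t).+1) @[n --> \oo] --> u t.
Proof.
move=> urc t0 tT; have [->|tT'] := eqVneq t T.
  apply: cvg_near_cst; apply: nearW => n; congr u.
  have /andP[_ h] := cell_itv n T_gt0.
  apply/eqP; rewrite eq_le h andbT node_leT//.
  exact: cell_lt.
have {tT'} tT' : t < T by rewrite lt_neqAle tT'.
have b_cvg : node n (cell n t).+1 @[n --> \oo] --> t.
  apply: (@cvg_dist_bound _ R _ _ (fun n => T * 2^-1 ^+ n)).
    move=> n; have /andP[h1 h2] := cell_itv n t0.
    rewrite ger0_norm ?subr_ge0//; have := node_diff n (cell n t).
    by rewrite exprVn; lra.
  rewrite -[X in _ --> X](mulr0 T); apply: cvgM; first exact: cvg_cst.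
  by apply: cvg_expr; rewrite ger0_norm ?invr_ge0// invf_lt1// ltr1n.
move=> N Nu; have [eps /= eps0 hN] := urc t (ltW t0) tT' N Nu.
have : \forall n \near \oo, `|t - node n (cell n t).+1| < eps.
  exact: cvgr_dist_lt.
apply: filterS => n hn /=; have /andP[_ h] := cell_itv n t0.
(* The right end may be [t] itself, which the right neighbourhood filter excludes. *)
have [->|ne] := eqVneq (node n (cell n t).+1) t; first exact: nbhs_singleton.
by apply: hN => //=; rewrite lt_neqAle eq_sym ne.
Qed.

(** The value [0] outside []0, T]] confines the indices used to [i < 2 ^ n], so only finitely many
    values occur. *)
Definition step (V : zmodType) (n : nat) (c : nat -> V) (t : R) : V :=
  if 0 < t <= T then c (cell n t) else 0.

Lemma measurable_cell n i : measurable `]node n i, node n i.+1]%classic.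
Proof. exact: measurable_itv. Qed.

Lemma simple_fun_step (E : normedModType R) n (c : nat -> E) :
  @simple_fun _ (measurableTypeR R) R E (step n c).
Proof.
split.
  apply: (@sub_finite_set _ _ (0 |` [set c i | i in `I_(2 ^ n)])).
    move=> _ [t _ <-]; rewrite /step; case: ifPn => [/andP[t0 tT]|_]; last by left.
    by right; exists (cell n t) => //=; exact: cell_lt.
  by rewrite finite_setU; split; [exact: finite_set1|exact: finite_image].
move=> y.
have -> : step n c @^-1` [set y] =
   \bigcup_(i in [set i | (i < 2 ^ n)%N /\ c i = y]) `]node n i, node n i.+1]%classic
   `|` (~` `]0, T]%classic `&` [set t | 0 = y]).
  apply/seteqP; split => t /=; rewrite /step.
    case: ifPn => [/andP[t0 tT] cy|t0T y0]; [left|right].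
      by exists (cell n t); [split => //; exact: cell_lt|rewrite /= in_itv/= cell_itv].
    by split => //; rewrite in_itv/=; exact/negP.
  move=> [[i [iN <-]]|[]]; rewrite /= in_itv/=.
    move=> it; rewrite (cell_unique it) ifT//; move/andP : it => [it ti].
    rewrite (le_lt_trans _ it) ?node_ge0//= (le_trans ti)//.
    exact: node_leT.
  by move=> /negP/negbTE -> ->.
apply: measurableU.
  by apply: bigcup_measurable => i _; exact: measurable_cell.
apply: measurableI; first by apply: measurableC; exact: measurable_itv.
have [->|y0] := eqVneq y 0.
  by rewrite (_ : [set t | _] = setT)//; apply/seteqP; split.
rewrite (_ : [set t | _] = set0)//; apply/seteqP; split => // t /= y0'.
by rewrite -y0' eqxx in y0.
Qed.

End DyadicGrid.

Lemma sum_blocks (R : zmodType) (N q : nat) (F : nat -> R) :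
  \sum_(0 <= i < N * q) F i =
  \sum_(0 <= j < N) \sum_(0 <= l < q) F (j * q + l)%N.
Proof.
elim: N => [|N IH]; first by rewrite mul0n !big_geq.
rewrite big_nat_recr//= -IH mulSn addnC (big_cat_nat (leq0n _) (leq_addr _ _))/=.
by congr (_ + _); rewrite -{1}[(N * q)%N]add0n big_addn addKn;
  apply: eq_bigr => l _; rewrite addnC.
Qed.

Section StepIntegral.
Context {R : realType} (T : R) (rho : R -> R).
Hypothesis T_gt0 : 0 < T.
Variable nu : {finite_measure set (measurableTypeR R) -> \bar R}.
Hypothesis nu_itv : forall s t, 0 <= s -> s <= t -> t <= T ->
  nu `]s, t]%classic = (rho t - rho s)%:E.

Definition mass (n i : nat) : R := rho (node T n i.+1) - rho (node T n i).

Lemma rho_ge0 s t : 0 <= s -> s <= t -> t <= T -> 0 <= rho t - rho s.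
Proof. by move=> s0 st tT; rewrite -lee_fin -nu_itv. Qed.

Lemma step_integrable (D : set (measurableTypeR R)) n (F : nat -> R) : measurable D ->
  nu.-integrable D (EFin \o step T n F).
Proof.
move=> mD; have hs := @simple_fun_step R T T_gt0 R n F.
have [M _ sM] := simple_fun_bounded hs.
apply: (bounded_integrable nu mD _ sM).
exact: (@simple_fun_measurable _ _ _ R _ id hs).
Qed.

Lemma Rintegral_step n (F : nat -> R) k : (k <= 2 ^ n)%N ->
  \int[nu]_(t in `]0, node T n k]) step T n F t =
  \sum_(0 <= i < k) F i * mass n i.
Proof.
elim: k => [_|k IH kN]; first by rewrite node0 set_itvoc0 Rintegral_set0 big_geq.
have k0 := node_ge0 T_gt0 n k.
have kk : node T n k <= node T n k.+1 by rewrite node_le.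
have -> : `]0, node T n k.+1]%classic =
    (`]0, node T n k] `|` `]node T n k, node T n k.+1])%classic :> set R.
  by rewrite -itv_bndbnd_setU// bnd_simp.
rewrite Rintegral_setU//; first last.
- apply/disj_setPS => t [/=]; rewrite !in_itv/= => /andP[_ h] /andP[h' _].
  by have := lt_le_trans h' h; rewrite ltxx.
- by apply: step_integrable; apply: measurableU.
rewrite IH ?(ltnW kN)// big_nat_recr//=; congr (_ + _).
rewrite (@eq_Rintegral _ _ _ _ _ (cst (F k))) ?Rintegral_cst//; last first.
  move=> t; rewrite inE/= in_itv/= => kt; rewrite /step (cell_unique T_gt0 kt).
  case/andP: kt => kt tk.
  by rewrite ifT// (le_lt_trans k0 kt)/= (le_trans tk)// node_leT.
congr (_ * _); rewrite -[RHS]/(fine (mass n k)%:E); congr fine.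
by apply: nu_itv; rewrite ?(node_leT T_gt0).
Qed.

End StepIntegral.

(** * The martingale of dyadic difference quotients *)

Section Martingale.
Context {R : realType} {E : completeNormedModType R}.
Variables (ip : {dot E for (@idfun R)}).
Hypothesis ip_norm : norm_from_dot ip.
Variables (T : R) (rho : R -> R).
Hypothesis T_gt0 : 0 < T.
Hypothesis rho_lt : forall s t, 0 <= s -> s < t -> t <= T -> rho s < rho t.
Variables (K : R) (w : R -> E).
Hypothesis w_lip : forall s t, 0 <= s -> s <= t -> t <= T ->
  `|w t - w s| <= K * (rho t - rho s).

Definition incr (n i : nat) : E := w (node T n i.+1) - w (node T n i).
(* [avg n] is a martingale for the dyadic filtration of [nu], and [energy n] is
   its squared L2 norm. *)
Definition avg (n i : nat) : E := (mass T rho n i)^-1 *: incr n i.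
Definition energy (n : nat) : R :=
  \sum_(0 <= i < 2 ^ n) `|avg n i| ^+ 2 * mass T rho n i.

Lemma mass_gt0 n i : (i < 2 ^ n)%N -> 0 < mass T rho n i.
Proof.
move=> iN; rewrite subr_gt0; apply: rho_lt.
- exact: node_ge0.
- by rewrite node_lt.
- exact: node_leT.
Qed.

Lemma lipschitz_constant_ge0 : 0 <= K.
Proof.
have h := rho_lt (lexx 0) T_gt0 (lexx T).
have := le_trans (normr_ge0 _) (w_lip (lexx 0) (ltW T_gt0) (lexx T)).
by rewrite pmulr_lge0// subr_gt0.
Qed.

Lemma incrE n i : (i < 2 ^ n)%N -> mass T rho n i *: avg n i = incr n i.
Proof.
by move=> iN; rewrite /avg scalerA divff ?scale1r// gt_eqF// mass_gt0.
Qed.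

Lemma avg_le n i : (i < 2 ^ n)%N -> `|avg n i| <= K.
Proof.
move=> iN; have m0 := mass_gt0 iN.
rewrite /avg normrZ gtr0_norm ?invr_gt0// mulrC ler_pdivrMr//.
apply: w_lip; [exact: node_ge0|by rewrite node_le|exact: node_leT].
Qed.

(** Pythagoras for martingale increments. On a coarse cell the fine increments add up to the coarse
    one, so pairing the fine quotients with the coarse quotient gives exactly [energy n]. *)
Lemma energy_diff n m : (n <= m)%N ->
  \sum_(0 <= i < 2 ^ m)
    `|avg m i - avg n (i %/ 2 ^ (m - n))| ^+ 2 * mass T rho m i =
  energy m - energy n.
Proof.
move=> nm; set q := (2 ^ (m - n))%N.
have q0 : (0 < q)%N by rewrite expn_gt0.
have eN : (2 ^ m = 2 ^ n * q)%N by rewrite -expnD subnKC.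
have blk (G : nat -> R) :
    \sum_(0 <= i < 2 ^ m) G i * mass T rho m i =
    \sum_(0 <= j < 2 ^ n) \sum_(0 <= l < q) G (j * q + l)%N * mass T rho m (j * q + l).
  by rewrite eN sum_blocks.
have divq j l : (l < q)%N -> ((j * q + l) %/ q)%N = j.
  by move=> lq; rewrite divnMDl// divn_small// addn0.
(* Stated for any [V] because it is applied both to [rho] and to [w]. *)
have tele (V : zmodType) (u : R -> V) j :
    \sum_(0 <= l < q) (u (node T m (j * q + l).+1) - u (node T m (j * q + l))) =
    u (node T n j.+1) - u (node T n j).
  under eq_bigr do rewrite -addnS.
  rewrite (telescope_sumr (fun l => u (node T m (j * q + l))))// addn0.
  by rewrite -mulSnr !node_refine.
have norm2 : \sum_(0 <= i < 2 ^ m) `|avg n (i %/ q)| ^+ 2 * mass T rho m i = energy n.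
  rewrite (blk (fun i => `|avg n (i %/ q)| ^+ 2)); apply: eq_bigr => j _.
  rewrite [mass T rho n j]/mass -(tele R rho) mulr_sumr.
  apply: eq_big_nat => l /andP[_ lq].
  by rewrite divq.
have cross : \sum_(0 <= i < 2 ^ m) ip (avg m i) (avg n (i %/ q)) * mass T rho m i =
    energy n.
  rewrite (blk (fun i => ip (avg m i) (avg n (i %/ q)))).
  apply: eq_big_nat => j /andP[_ jN].
  rewrite -(dot_norm ip_norm) mulrC -dotZl incrE// {1}/incr -(tele E w).
  transitivity (\sum_(0 <= l < q) ip (incr m (j * q + l)) (avg n j)).
    apply: eq_big_nat => l /andP[_ lq]; rewrite divq// mulrC -dotZl incrE//.
    by rewrite eN; nia.
  by rewrite -linear_sumlz.
transitivity (\sum_(0 <= i < 2 ^ m) (`|avg m i| ^+ 2 * mass T rho m i +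
   `|avg n (i %/ q)| ^+ 2 * mass T rho m i -
   2 * (ip (avg m i) (avg n (i %/ q)) * mass T rho m i))).
  by apply: eq_bigr => i _; rewrite (normB_sqr ip_norm); ring.
rewrite sumrB big_split/= norm2 -mulr_sumr cross -/(energy m); ring.
Qed.

End Martingale.

(** The rate [4^-k] for squared L2 norms is chosen to give the summable rate [2^-k] for L1 norms. *)
Lemma rapid_subsequence (R : realType) (e : nat -> R) (B : R) :
    {homo e : n m / (n <= m)%N >-> n <= m} -> (forall n, e n <= B) ->
  exists sub : nat -> nat, [/\ forall k, (k <= sub k)%N,
    forall k, (sub k <= sub k.+1)%N &
    forall k, e (sub k.+1) - e (sub k) <= 4^-1 ^+ k].
Proof.
move=> end_ eB.
have ecvg : cvgn e.
  by apply: nondecreasing_is_cvgn => //; exists B => _ [n _ <-].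
have le_lim := nondecreasing_cvgn_le end_ ecvg.
have /choice[N HN] k : exists N, forall n, (N <= n)%N -> limn e - e n <= 4^-1 ^+ k.
  have [N _ HN] : \forall n \near \oo, limn e - 4^-1 ^+ k < e n.
    by apply: (cvgr_gt _ ecvg); rewrite gtrBl exprn_gt0// invr_gt0.
  by exists N => n /HN/= /ltW; lra.
(* Partial sums of the thresholds dominate each threshold and are monotone; the added [1] makes them
   at least [k]. *)
exists (fun k => \sum_(0 <= j < k.+1) (N j).+1)%N; split => k.
- elim: k => // k IH; rewrite big_nat_recr//=; lia.
- by rewrite [leqRHS]big_nat_recr//= leq_addr.
- have : limn e - e (\sum_(0 <= j < k.+1) (N j).+1)%N <= 4^-1 ^+ k.
    by apply: HN; rewrite big_nat_recr//=; lia.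
  by have := le_lim (\sum_(0 <= j < k.+2) (N j).+1)%N; lra.
Qed.

(** * Almost everywhere convergence of the quotients to a density *)

Section Density.
Context {R : realType} {E : completeNormedModType R}.
Variables (ip : {dot E for (@idfun R)}).
Hypothesis ip_norm : norm_from_dot ip.
Variables (T : R) (rho : R -> R).
Hypothesis T_gt0 : 0 < T.
Variable nu : {finite_measure set (measurableTypeR R) -> \bar R}.
Hypothesis nu_itv : forall s t, 0 <= s -> s <= t -> t <= T ->
  nu `]s, t]%classic = (rho t - rho s)%:E.
Hypothesis rho_lt : forall s t, 0 <= s -> s < t -> t <= T -> rho s < rho t.
Hypothesis rho_rc : right_continuous_on T rho.
Variables (K : R) (w : R -> E).
Hypothesis w_lip : forall s t, 0 <= s -> s <= t -> t <= T ->
  `|w t - w s| <= K * (rho t - rho s).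

Local Notation avg := (avg T rho w).
Local Notation mass := (mass T rho).
Local Notation energy := (energy T rho w).
Local Notation G n := (step T n (avg n)).

Let K0 : 0 <= K := lipschitz_constant_ge0 T_gt0 rho_lt w_lip.

Lemma energy_nd : {homo energy : n m / (n <= m)%N >-> n <= m}.
Proof.
move=> n m nm; rewrite -subr_ge0 -(energy_diff ip_norm T_gt0 rho_lt w nm).
rewrite big_nat_cond sumr_ge0// => i /andP[/andP[_ iN] _].
by rewrite mulr_ge0 ?exprn_ge0// ltW// mass_gt0.
Qed.

Lemma sum_mass n : \sum_(0 <= i < 2 ^ n) mass n i = rho T - rho 0.
Proof.
rewrite (telescope_sumr (fun i => rho (node T n i)))//.
by rewrite node_last node0.
Qed.

Lemma energy_le n : energy n <= K ^+ 2 * (rho T - rho 0).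
Proof.
rewrite -(sum_mass n) mulr_sumr; apply: ler_sum_nat => i /andP[_ iN].
by rewrite ler_wpM2r ?(ltW (mass_gt0 _ _ _))// lerXn2r ?nnegrE// avg_le.
Qed.

Lemma step_avg_le n t : `|G n t| <= K.
Proof.
rewrite /step; case: ifPn => [/andP[t0 tT]|_]; last by rewrite normr0.
by apply: (avg_le T_gt0 rho_lt w_lip); exact: cell_lt.
Qed.

(** Weighting [1] by [2^-k] and the square by [2^k] passes from L2 to L1: the first part contributes
    [2^-k] times the total mass, the second at most [2^k 4^-k = 2^-k]. *)
Lemma Rintegral_step_avgB n m k : (n <= m)%N ->
    energy m - energy n <= 4^-1 ^+ k ->
  \int[nu]_(t in `]0, T]) `|G m t - G n t| <= 2^-1 ^+ k * (rho T - rho 0 + 1).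
Proof.
move=> nm le4; pose F i := `|avg m i - avg n (i %/ 2 ^ (m - n))|.
have -> : \int[nu]_(t in `]0, T]) `|G m t - G n t| =
    \int[nu]_(t in `]0, T]) step T m F t.
  apply: eq_Rintegral => t; rewrite inE/= in_itv/= => tT.
  by rewrite /step tT /F -(cell_refine T_gt0 nm)//; case/andP: tT.
rewrite -{1}(node_last T m) (Rintegral_step T_gt0 nu_itv)//.
apply: (@le_trans _ _ (\sum_(0 <= i < 2 ^ m)
    (2^-1 ^+ k * mass m i + 2 ^+ k * (F i ^+ 2 * mass m i)))).
  apply: ler_sum_nat => i /andP[_ iN].
  have m0 := ltW (mass_gt0 T_gt0 rho_lt iN).
  rewrite mulrA -mulrDl ler_wpM2r//.
  (* x <= 2^-k + 2^k x^2 *)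
  have F0 : 0 <= F i by exact: normr_ge0.
  have k0 : 0 < 2 ^+ k :> R by rewrite exprn_gt0.
  rewrite exprVn; have [h|h] := leP (F i) (2 ^- k).
    by rewrite (le_trans h)// lerDl mulr_ge0 ?exprn_ge0// ltW.
  apply: (@le_trans _ _ (2 ^+ k * F i ^+ 2)); last by rewrite lerDr invr_ge0 ltW.
  rewrite expr2 mulrA ler_peMl//; move/ltW: h; rewrite -div1r ler_pdivrMr//.
  by rewrite mulrC.
rewrite big_split/= -!mulr_sumr sum_mass (energy_diff ip_norm T_gt0 rho_lt w nm).
rewrite [leRHS]mulrDr mulr1 lerD2l.
apply: (@le_trans _ _ (2 ^+ k * 4^-1 ^+ k)).
  by rewrite ler_wpM2l// exprn_ge0.
by rewrite -exprMn (_ : 2 * 4^-1 = 2^-1 :> R)//; field.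
Qed.

(** Up to the right end [b] of the cell of [t] the integral telescopes to the increment of [w]
    exactly. What happens on []t, b]] is counted once for the integral and once for [w], hence the
    factor [2]. *)
Lemma Rintegral_dot_step t n z : 0 < t -> t <= T ->
  `|\int[nu]_(x in `]0, t]) ip (G n x) z - ip (w t - w 0) z| <=
  2 * K * `|z| * (rho (node T n (cell T n t).+1) - rho t).
Proof.
move=> t0 tT; set i := cell T n t; set b := node T n i.+1.
have iN : (i < 2 ^ n)%N by exact: cell_lt.
have /andP[_ tb] : node T n i < t <= b by exact: cell_itv.
have bT : b <= T by exact: node_leT.
have GF : (fun x => ip (G n x) z) = step T n (fun j => ip (avg n j) z).
  by apply/funext => x; rewrite /step; case: ifP => //; rewrite linear0l.
have iF (D : set (measurableTypeR R)) : measurable D ->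
    nu.-integrable D (EFin \o (fun x => ip (G n x) z)).
  by move=> mD; rewrite GF; apply: step_integrable.
have intb : \int[nu]_(x in `]0, b]) ip (G n x) z = ip (w b - w 0) z.
  rewrite GF (Rintegral_step T_gt0 nu_itv)//.
  transitivity (\sum_(0 <= j < i.+1) ip (incr T w n j) z).
    apply: eq_big_nat => j /andP[_ ji].
    by rewrite mulrC -dotZl (incrE T_gt0 rho_lt)// (leq_trans ji).
  rewrite -linear_sumlz (telescope_sumr (fun j => w (node T n j)))//.
  by rewrite node0.
have split_b : \int[nu]_(x in `]0, b]) ip (G n x) z =
    \int[nu]_(x in `]0, t]) ip (G n x) z + \int[nu]_(x in `]t, b]) ip (G n x) z.
  have -> : `]0, b]%classic = (`]0, t] `|` `]t, b])%classic :> set R.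
    by rewrite -itv_bndbnd_setU// bnd_simp// ltW.
  rewrite Rintegral_setU//.
    by apply: iF; exact: measurableU.
  apply/disj_setPS => x [/=]; rewrite !in_itv/= => /andP[_ h] /andP[h' _].
  by have := lt_le_trans h' h; rewrite ltxx.
have r0 : 0 <= rho b - rho t by apply: (rho_ge0 nu_itv) => //; exact: ltW.
have rest : `|\int[nu]_(x in `]t, b]) ip (G n x) z| <= K * `|z| * (rho b - rho t).
  have mtb : measurable (`]t, b]%classic : set (measurableTypeR R)).
    exact: measurable_itv.
  have le_abs := le_normr_Rintegral mtb (iF _ mtb).
  apply: (le_trans le_abs).
  apply: (@le_trans _ _ (\int[nu]_(x in `]t, b]) (K * `|z|))).
    apply: le_Rintegral => //; first exact: (integrable_norm (iF _ mtb)).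
      exact: finite_measure_integrable_cst.
    move=> x _; apply: (le_trans (cauchy_schwarz ip_norm _ _)).
    by rewrite ler_wpM2r// step_avg_le.
  rewrite Rintegral_cst// (_ : fine _ = rho b - rho t)//.
  rewrite -[RHS]/(fine (rho b - rho t)%:E); congr fine.
  by apply: nu_itv => //; exact: ltW.
have -> : ip (w t - w 0) z = ip (w b - w 0) z - ip (w b - w t) z.
  by rewrite !(dotDl, dotNl); ring.
have : `|ip (w b - w t) z| <= K * `|z| * (rho b - rho t).
  apply: (le_trans (cauchy_schwarz ip_norm _ _)); rewrite mulrAC ler_wpM2r//.
  by apply: w_lip => //; exact: ltW.
move: rest; rewrite -intb split_b !ler_norml; lra.
Qed.

(** The subsequence is part of the conclusion because a variational inequality will be passed to the
    limit along these very quotients. *)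
Lemma martingale_density : exists g : R -> E, [/\
  @bounded_limit _ (measurableTypeR R) R E K g,
  forall t z, 0 <= t <= T -> ip (w t - w 0) z = \int[nu]_(x in `]0, t]) ip (g x) z &
  exists2 sub : nat -> nat, (forall k, (k <= sub k)%N) &
    {ae nu, forall t, 0 < t <= T ->
      avg (sub k) (cell T (sub k) t) @[k --> \oo] --> g t}].
Proof.
have [sub [sub_ge sub_nd sub_e]] := rapid_subsequence energy_nd energy_le.
pose H k := G (sub k).
have hH k : @simple_fun _ (measurableTypeR R) R E (H k) by exact: simple_fun_step.
pose dH k t := `|H k.+1 t - H k t|.
have dH0 k t : (0 <= (dH k t)%:E)%E by rewrite lee_fin /dH.
have mdH k : measurable_fun (setT : set (measurableTypeR R)) (dH k).
  apply: (@simple_fun_measurable _ (measurableTypeR R) R E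
    (fun x => H k.+1 x - H k x) (fun v => `|v|)).
  exact: (@simple_fun2 _ (measurableTypeR R) R E E E (fun a b => a - b) _ _
    (hH k.+1) (hH k)).
(* An integrable sum of the distances between consecutive terms is finite a.e., which makes the
   sequence converge absolutely there. *)
pose F t := (\sum_(0 <= k <oo) (dH k t)%:E)%E.
have mF : measurable_fun (setT : set (measurableTypeR R)) F.
  apply: (@ge0_emeasurable_sum _ _ _ setT (fun k t => (dH k t)%:E) xpredT).
    by [].
  by move=> k _; apply/measurable_EFinP; exact: mdH.
have F0 t : (0 <= F t)%E by apply: nneseries_ge0 => k _ _.
have mI : measurable (`]0, T]%classic : set (measurableTypeR R)).
  exact: measurable_itv.
pose c := rho T - rho 0 + 1.
have c0 : 0 <= c by rewrite addr_ge0// (rho_ge0 nu_itv)// ltW.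
have iF : nu.-integrable `]0, T]%classic F.
  apply/integrableP; split; first exact: measurable_funTS.
  rewrite (@eq_integral _ _ _ nu _ F); last by move=> t _; rewrite gee0_abs.
  rewrite integral_nneseries//; last first.
    by move=> k; apply: measurable_funTS; apply/measurable_EFinP; exact: mdH.
  (* The bounds [2^-k c] sum to [2 c]; they have the form [2 c / 2^(k+1)] used by
     [epsilon_trick0]. *)
  apply: (@le_lt_trans _ _ (2 * c)%:E); last exact: ltry.
  apply: le_trans (epsilon_trick0 xpredT (_ : 0 <= 2 * c)); last by rewrite mulr_ge0.
  apply: lee_nneseries => k _.
    by move=> _; apply: integral_ge0 => t _; exact: dH0.
  have := Rintegral_step_avgB (sub_nd k) (sub_e k).
  have -> : \int[nu]_(t in `]0, T]) `|G (sub k.+1) t - G (sub k) t| =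
    fine (\int[nu]_(t in `]0%R, T]) (dH k t)%:E)%E by [].
  rewrite -lee_fin fineK; last first.
    apply: integrable_fin_num => //.
    apply: (@bounded_integrable _ _ _ nu _ (dH k) (K + K)) => // t.
    by rewrite normr_id (le_trans (ler_normB _ _))// lerD// step_avg_le.
  move/le_trans; apply; rewrite lee_fin -/c natrX exprS invfM exprVn.
  by rewrite mulrACA divff ?pnatr_eq0// mul1r mulrC.
pose A : set (measurableTypeR R) := [set t | F t < +oo]%E.
have mA : measurable A.
  rewrite (_ : A = ~` (F @^-1` [set +oo%E])).
    by apply: measurableC; rewrite -[X in measurable X]setTI; exact: mF.
  by apply/seteqP; split => t /=; rewrite /A /= ltey => /eqP.
have cvgA t : A t -> cvgn (H ^~ t).
  move=> At; pose u k := H k.+1 t - H k t.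
  have : cvgn (series u).
    apply: normed_cvg; apply: nondecreasing_is_cvgn.
      by move=> n m nm; apply: (nondecreasing_series (u_ := fun k => `|u k|)).
    exists (fine (F t)) => _ [n _ <-]; rewrite -lee_fin fineK.
      rewrite -[X in X%:E]/(\sum_(0 <= k < n) `|u k|) -sumEFin; exact: nneseries_lim_ge.
    by rewrite ge0_fin_numE.
  move=> cu; have HE : H ^~ t = (fun n => H 0%N t + series u n).
    apply/funext => n; rewrite -[series u n]/(\sum_(0 <= k < n) u k).
    rewrite (telescope_sumr (fun k => H k t))//.
    by rewrite addrCA subrr addr0.
  by rewrite HE; apply: is_cvgD; [exact: is_cvg_cst|exact: cu].
(* Setting the steps to [0] off [A] yields convergence at every point, as [bounded_limit]
   demands. *)
pose s k t := if t \in A then H k t else 0.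
pose g t := if t \in A then limn (H ^~ t) else 0.
have hs k : @simple_fun _ (measurableTypeR R) R E (s k) :=
  simple_fun_restrict mA (hH k).
have sK k t : `|s k t| <= K.
  by rewrite /s; case: ifP; rewrite ?normr0// step_avg_le.
have sg t : s k t @[k --> \oo] --> g t.
  rewrite /s /g; case: ifPn => [/set_mem/cvgA//|_]; exact: cvg_cst.
have hg : @bounded_limit _ (measurableTypeR R) R E K g by exists s.
have aeA : {ae nu, forall t, 0 < t <= T -> A t}.
  apply: filterS (integrable_ae mI iF) => t h tT.
  by rewrite /A/= -ge0_fin_numE//; apply: h; rewrite /= in_itv.
exists g; split => //.
- move=> t z /andP[t0 tT].
  have [->|tn0] := eqVneq t 0.
    by rewrite subrr linear0l set_itvoc0 Rintegral_set0.
  have {tn0} t0' : 0 < t by rewrite lt_neqAle eq_sym tn0.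
  have mt : measurable (`]0, t]%classic : set (measurableTypeR R)).
    exact: measurable_itv.
  have [v vz cv] := cvg_simple_integral ip_norm mt hg hs
    (bounded_limit_cvg_L1 nu mt hs sK sg).
  rewrite -vz.
  have h1 : ip (simple_integral nu `]0, t]%classic (s k)) z @[k --> \oo] --> ip v z.
    by apply: (cvg_dot ip_norm) => //; exact: cvg_cst.
  have h2 : ip (simple_integral nu `]0, t]%classic (s k)) z @[k --> \oo] -->
      ip (w t - w 0) z.
    pose e n := 2 * K * `|z| * (rho (node T n (cell T n t).+1) - rho t).
    have e0 : e n @[n --> \oo] --> 0.
      rewrite -(mulr0 (2 * K * `|z|)) -(subrr (rho t)).
      apply: cvgM; first exact: cvg_cst.
      apply: cvgB; last exact: cvg_cst.
      exact: right_continuous_node.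
    apply: (@cvg_dist_bound _ _ _ _ (e \o sub)).
      move=> k; rewrite dot_simple_integral//.
      have -> : \int[nu]_(x in `]0, t]) ip (s k x) z =
          \int[nu]_(x in `]0, t]) ip (H k x) z.
        have eq_ae : {ae nu, forall x, `]0, t]%classic x ->
            (ip (s k x) z)%:E = (ip (H k x) z)%:E}.
          apply: (@filterS _ _ (ae_filter_ringOfSetsType nu) _ _ _ aeA) => x hx.
          rewrite /= in_itv/= => /andP[x0 xt].
          by rewrite /s mem_set//; apply: hx; rewrite x0 (le_trans xt).
        rewrite /Rintegral; congr fine; apply: ae_eq_integral => //.
        - apply/measurable_EFinP/measurable_funTS.
          exact: (@simple_fun_measurable _ _ _ E _ (fun a => ip a z) (hs k)).
        - apply/measurable_EFinP/measurable_funTS.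
          exact: (@simple_fun_measurable _ _ _ E _ (fun a => ip a z) (hH k)).
      exact: Rintegral_dot_step.
    apply: cvg_comp e0 => B [N _ NB]; exists N => // n /= Nn.
    by apply: NB; exact: leq_trans (sub_ge n).
  exact: cvg_unique h2 h1.
- exists sub => //.
  apply: (@filterS _ _ (ae_filter_ringOfSetsType nu) _ _ _ aeA) => t At tT.
  have {}At := At tT.
  have := sg t; rewrite /s mem_set//; apply: cvg_trans; apply: near_eq_cvg.
  by apply: nearW => k; rewrite /H /step tT.
Qed.

End Density.

(** * Existence for the sweeping process with a bounded perturbation *)

Lemma ball_compact_translate (R : realType) (E : normedModType R) (C : set E)
    (v : E) :
  ball_compact C -> ball_compact [set x | C (x - v)].
Proof.
move=> cC x r.
have -> : [set x | C (x - v)] `&` closed_ball_ Num.norm x r =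
    (fun y => y + v) @` (C `&` closed_ball_ Num.norm (x - v) r).
  apply/seteqP; split => y /=.
    move=> [Cy xy]; exists (y - v); rewrite ?subrK//; split => //.
    by rewrite /closed_ball_/= opprB addrA subrK.
  move=> [y' [Cy xy] <-]; rewrite addrK; split => //.
  by move: xy; rewrite /closed_ball_/= opprD addrA addrAC.
apply: continuous_compact (cC _ _); apply: continuous_subspaceT => y.
by apply: cvgD => //; exact: cvg_cst.
Qed.

Lemma convex_translate (R : realType) (E : normedModType R) (C : set E) (v : E) :
  convex_set C -> convex_set [set x | C (x - v)].
Proof.
move=> cC x y l; rewrite !inE /= => Cx Cy.
have := cC (x - v) (y - v) l; rewrite !inE => /(_ Cx Cy).
rewrite /conv/=.
have -> : l%:num *: (x - v) + (1 - l%:num) *: (y - v) =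
   l%:num *: x + (1 - l%:num) *: y - v.
  rewrite !scalerBr addrACA -opprD -scalerDl.
  by rewrite [X in X *: v]addrC subrK scale1r.
by [].
Qed.

Section Existence.
Context {R : realType} {E : completeNormedModType R}.
Variables (ip : {dot E for (@idfun R)}).
Hypothesis ip_norm : norm_from_dot ip.
Variables (T : R) (rho : R -> R).
Hypothesis T_gt0 : 0 < T.
Variable nu : {finite_measure set (measurableTypeR R) -> \bar R}.
Hypothesis nu_itv : forall s t, 0 <= s -> s <= t -> t <= T ->
  nu `]s, t]%classic = (rho t - rho s)%:E.
Hypothesis rho_lt : forall s t, 0 <= s -> s < t -> t <= T -> rho s < rho t.
Hypothesis rho_rc : right_continuous_on T rho.

Lemma bochner_primitive (M : R) (h : R -> E) :
  @bounded_limit _ (measurableTypeR R) R E M h ->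
  exists F : R -> E, [/\ F 0 = 0,
    forall t z, ip (F t) z = \int[nu]_(x in `]0, t]) ip (h x) z &
    forall s t, 0 <= s -> s <= t -> t <= T -> `|F t - F s| <= M * (rho t - rho s)].
Proof.
move=> hh; have M0 : 0 <= M := le_trans (normr_ge0 _) (bounded_limit_le (0 : R) hh).
have /choice[F FE] t : exists v, forall z,
    ip v z = \int[nu]_(x in `]0, t]) ip (h x) z.
  by apply: bochner_integral_exists hh => //; exact: measurable_itv.
exists F; split => //.
  by apply: (dot_weak_eq ip_norm) => z; rewrite FE linear0l set_itvoc0 Rintegral_set0.
move=> s t s0 st tT; apply: (dot_weak_norm ip_norm).
  by rewrite mulr_ge0// (rho_ge0 nu_itv).
move=> z; have ih (D : set (measurableTypeR R)) : measurable D ->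
    nu.-integrable D (EFin \o (fun x => ip (h x) z)).
  by move=> mD; exact: bounded_limit_dot_integrable hh.
rewrite dotDl dotNl !FE.
have -> : `]0, t]%classic = (`]0, s] `|` `]s, t])%classic :> set R.
  by rewrite -itv_bndbnd_setU// bnd_simp.
rewrite Rintegral_setU//; first last.
- apply/disj_setPS => x [/=]; rewrite !in_itv/= => /andP[_ xs] /andP[sx _].
  by have := lt_le_trans sx xs; rewrite ltxx.
- by apply: ih; exact: measurableU.
rewrite addrAC subrr add0r.
have mst : measurable (`]s, t]%classic : set (measurableTypeR R)).
  exact: measurable_itv.
apply: (@le_trans _ _ (\int[nu]_(x in `]s, t]) (M * `|z|))).
  apply: le_Rintegral => //; [exact: ih|exact: finite_measure_integrable_cst|].
  move=> x _; apply: (le_trans (dot_ler ip_norm _ _)); rewrite ler_wpM2r//.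
  exact: bounded_limit_le hh.
rewrite Rintegral_cst// (_ : fine _ = rho t - rho s); last first.
  by rewrite -[RHS]/(fine (rho t - rho s)%:E); congr fine; exact: nu_itv.
by rewrite mulrAC.
Qed.

Let I n t : set (measurableTypeR R) :=
  `]node T n (cell T n t), node T n (cell T n t).+1]%classic.

(** The cells of [t] are nested with lengths [T / 2^n], so without [t] they decrease to the empty
    set, and the finite measure is continuous from above. *)
Lemma cell_mass_vanish t : 0 < t ->
  fine (nu (I n t `\ t)) @[n --> \oo] --> 0.
Proof.
move=> t0.
have mI n : measurable (I n t) by exact: measurable_itv.
have mIt n : measurable (I n t `\ t) by apply: measurableD.
suff : nu (I n t `\ t) @[n --> \oo] --> 0%E by move/fine_cvgP => [].
have I0 : \bigcap_n (I n t `\ t) = set0.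
  apply/seteqP; split => // x hx.
  suff xt : x = t by have [_] := hx 0%N Logic.I; apply.
  apply/eqP; rewrite -subr_eq0 -normr_le0.
  apply: (@cvgr_to_ge _ \oo _ _ (fun n => T * 2^-1 ^+ n)).
    rewrite -[X in _ --> X](mulr0 T); apply: cvgM; first exact: cvg_cst.
    by apply: cvg_expr; rewrite ger0_norm ?invr_ge0// invf_lt1// ltr1n.
  apply: nearW => n; have [] := hx n Logic.I.
  rewrite /I /= in_itv/= => /andP[h1 h2] _.
  have /andP[h3 h4] := cell_itv T_gt0 n t0.
  have := node_diff T n (cell T n t); rewrite exprVn ler_norml; lra.
have := @nonincreasing_cvg_mu _ _ _ nu (fun n => I n t `\ t).
rewrite I0 measure0; apply => //.
- by rewrite ltey_eq fin_num_measure.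
- move=> n m nm; apply/subsetPset => x [xI xt]; split => //.
  move: xI; rewrite /I /= !in_itv/= (cell_refine T_gt0 nm t0).
  rewrite -!(node_refine T _ nm) => /andP[h1 h2]; apply/andP; split.
    apply: le_lt_trans h1; rewrite node_le//; exact: leq_trunc_div.
  apply: (le_trans h2); rewrite node_le// -ltn_divLR// expn_gt0//.
Qed.

Variable C : R -> set E.
Hypothesis C_neq0 : forall t, 0 <= t <= T -> C t !=set0.
Hypothesis C_convex : forall t, 0 <= t <= T -> convex_set (C t).
Hypothesis C_compact : forall t, 0 <= t <= T -> ball_compact (C t).
Hypothesis C_lip : forall s t x, 0 <= s <= T -> 0 <= t <= T -> C s x ->
  exists2 y, C t y & `|x - y| <= `|rho t - rho s|.

(* With [F] the primitive of [h], the function [w = u + F] solves the unperturbed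
   process moved by the sets [C t + F t]. *)
Lemma sweeping_exists (M : R) (h : R -> E) (u0 : E) :
  @bounded_limit _ (measurableTypeR R) R E M h -> C 0 u0 ->
  exists (L : R) (u g : R -> E),
  [/\ u 0 = u0, forall t, 0 <= t <= T -> C t (u t),
      @bounded_limit _ (measurableTypeR R) R E L g,
      forall t z, 0 <= t <= T ->
        ip (u t - u 0) z = \int[nu]_(x in `]0, t]) ip (g x) z &
      {ae nu, forall t, 0 < t <= T -> forall y, C t y ->
        0 <= ip (g t + h t) (y - u t)}].
Proof.
move=> hh Cu0; have M0 : 0 <= M := le_trans (normr_ge0 _) (bounded_limit_le (0 : R) hh).
have [F [F0 FE Flip]] := bochner_primitive hh.
pose D t := [set x | C t (x - F t)].
have rho_nd : {in `[0, T] &, {homo rho : s t / s <= t}}.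
  move=> s t; rewrite !in_itv/= => /andP[s0 _] /andP[_ tT] st.
  by rewrite -subr_ge0 (rho_ge0 nu_itv).
(* With respect to [rho], the sets [C] move at speed at most [1] and the translation [F] at speed at
   most [M]. *)
have K_ge0 : 0 <= 1 + M by rewrite addr_ge0.
have D_neq0 t : 0 <= t <= T -> D t !=set0.
  by move=> /C_neq0[x Cx]; exists (x + F t); rewrite /D/= addrK.
have D_convex t : 0 <= t <= T -> convex_set (D t).
  by move=> tT; apply: convex_translate; exact: C_convex.
have D_compact t : 0 <= t <= T -> ball_compact (D t).
  by move=> tT; apply: ball_compact_translate; exact: C_compact.
have F_lip s t : 0 <= s <= T -> 0 <= t <= T -> `|F t - F s| <= M * `|rho t - rho s|.
  move=> /andP[s0 sT] /andP[t0 tT]; have [st|/ltW ts] := leP s t.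
    by rewrite (le_trans (Flip _ _ s0 st tT))// ler_wpM2l// ler_norm.
  rewrite distrC (distrC (rho t)) (le_trans (Flip _ _ t0 ts sT))//.
  by rewrite ler_wpM2l// ler_norm.
have D_lip s t x : 0 <= s <= T -> 0 <= t <= T -> D s x ->
    exists2 y, D t y & `|x - y| <= (1 + M) * `|rho t - rho s|.
  move=> sT tT /(C_lip sT tT)[y Cy xy]; exists (y + F t); first by rewrite /D/= addrK.
  have -> : x - (y + F t) = (x - F s - y) - (F t - F s).
    by rewrite opprB (addrAC x) [RHS]addrA subrK opprD addrA.
  rewrite (le_trans (ler_normB _ _))// mulrDl mul1r lerD// F_lip//.
have Du0 : D 0 u0 by rewrite /D/= F0 subr0.
have [w [w0 wD wlip wvi]] := catching_up_limit ip_norm K_ge0 rho_nd D_neq0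
  D_convex D_compact D_lip (ltW T_gt0) Du0.
have [gw [hgw gwE [sub sub_ge gw_ae]]] :=
  martingale_density ip_norm T_gt0 nu_itv rho_lt rho_rc wlip.
exists (1 + M + M), (fun t => w t - F t), (fun t => gw t - h t); split.
- by rewrite w0 F0 subr0.
- by move=> t /wD.
- exact: bounded_limitB.
- move=> t z tT.
  have mt : measurable (`]0, t]%classic : set (measurableTypeR R)).
    exact: measurable_itv.
  under eq_Rintegral do rewrite dotDl dotNl.
  rewrite RintegralB//; last 2 first.
    exact: bounded_limit_dot_integrable hgw.
    exact: bounded_limit_dot_integrable hh.
  by rewrite -gwE// -FE F0 !(dotDl, dotNl) linear0l; ring.
apply: (@filterS _ _ (ae_filter_ringOfSetsType nu) _ _ _ gw_ae) => t gt tT y Cy.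
have {gt} := gt tT; case/andP: tT => t0 tT gt.
rewrite subrK dot_sym.
pose e k := fine (nu (I (sub k) t `\ t)).
have e0 : e k @[k --> \oo] --> 0.
  have := cell_mass_vanish t0; apply: cvg_comp => B [N _ NB]; exists N => // k /= Nk.
  by apply: NB; exact: leq_trans (sub_ge k).
have Dy : D t (y + F t) by rewrite /D/= addrK.
have lhs0 : - (2 * (1 + M) ^+ 2 * e k) @[k --> \oo] --> 0.
  rewrite -oppr0 -(mulr0 (2 * (1 + M) ^+ 2)).
  by apply: cvgN; apply: cvgM => //; exact: cvg_cst.
have rhs : ip (y - (w t - F t)) (avg T rho w (sub k) (cell T (sub k) t))
    @[k --> \oo] --> ip (y - (w t - F t)) (gw t).
  by apply: (cvg_dot ip_norm) => //; exact: cvg_cst.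
apply: (ler_cvg_to lhs0 rhs); apply: nearW => k.
have cN := cell_lt T_gt0 (sub k) t0 tT.
have /andP[at_ tb] := cell_itv T_gt0 (sub k) t0.
have m0 := mass_gt0 T_gt0 rho_lt cN.
rewrite /avg dotZr [leRHS]mulrC ler_pdivlMr// mulNr.
have -> : 2 * (1 + M) ^+ 2 * e k * mass T rho (sub k) (cell T (sub k) t) =
    2 * (1 + M) ^+ 2 * mass T rho (sub k) (cell T (sub k) t) * e k by ring.
rewrite opprB addrA.
have := wvi (y + F t) _ t _ (e k) (node_ge0 T_gt0 _ _) at_ tb
  (node_leT T_gt0 cN) Dy; apply.
move=> s as_ st; set a := node _ _ _ in at_ as_ *; set b := node _ _ _ in tb *.
have bT : b <= T by exact: node_leT.
have a0 : 0 <= a by exact: node_ge0.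
have mas : measurable (`]a, s]%classic : set (measurableTypeR R)).
  exact: measurable_itv.
have mtb : measurable (`]t, b]%classic : set (measurableTypeR R)).
  exact: measurable_itv.
have mIt : measurable (I (sub k) t `\ t).
  by apply: measurableD => //; exact: measurable_itv.
(* Since [s < t], the intervals []a, s]] and []t, b]] are disjoint and contained in the cell of [t]
   deprived of [t]. *)
rewrite -lee_fin /e fineK ?fin_num_measure// EFinD.
rewrite -(nu_itv a0 as_) ?(le_trans (ltW st))// -(nu_itv (ltW t0) tb bT).
rewrite -measureU//; last first.
  apply/seteqP; split => // x [/=]; rewrite !in_itv/= => /andP[_ xs] /andP[tx _].
  by have := lt_trans (le_lt_trans xs st) tx; rewrite ltxx.
apply: le_measure; rewrite ?inE//; first exact: measurableU.
move=> x; rewrite /I /= !in_itv/= -/a -/b => -[/andP[ax xs]|/andP[tx xb]].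
  have xt := le_lt_trans xs st; rewrite ax (le_trans (ltW xt))//; split => // xE.
  by rewrite xE ltxx in xt.
rewrite (lt_trans at_ tx) xb; split => // xE.
by rewrite xE ltxx in tx.
Qed.

End Existence.

(** * The density of a measure dominated by another *)

Section DominatedDensity.
Local Open Scope charge_scope.
Context d (X : measurableType d) {R : realType}.
Variables lam nu : {finite_measure set X -> \bar R}.
Hypothesis lam_le : forall A, measurable A -> (lam A <= nu A)%E.

(** [dlambda_dnu] for a general pair of finite measures. *)
Definition rn_density (x : X) : R :=
  fine (('d (charge_of_finite_measure lam) '/d nu) x).

Lemma finite_measure_dominates : charge_of_finite_measure lam `<< nu.
Proof.
apply/null_content_dominatesP => A mA nuA.
by apply/eqP; rewrite eq_le measure_ge0 andbT -nuA; exact: lam_le.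
Qed.

Lemma rn_density_EFin :
  EFin \o rn_density = 'd (charge_of_finite_measure lam) '/d nu.
Proof.
apply/funext => x; rewrite /rn_density /= fineK//.
exact/Radon_Nikodym_fin_num/finite_measure_dominates.
Qed.

Lemma rn_density_integrable : nu.-integrable setT (EFin \o rn_density).
Proof.
by rewrite rn_density_EFin; exact/Radon_Nikodym_integrable/finite_measure_dominates.
Qed.

Lemma rn_density_measurable : measurable_fun setT rn_density.
Proof. by apply/measurable_EFinP; exact: measurable_int rn_density_integrable. Qed.

Lemma rn_density_integral A : measurable A ->
  (\int[nu]_(x in A) (rn_density x)%:E)%E = lam A.
Proof.
move=> mA; rewrite -[LHS]/(integral nu A (EFin \o rn_density)) rn_density_EFin.
by rewrite -Radon_Nikodym_integral//; exact: finite_measure_dominates.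
Qed.

Lemma null_of_integral_le0 (A : set X) (q : X -> R) : measurable A ->
    measurable_fun setT q -> (forall x, A x -> 0 < q x) ->
    (\int[nu]_(x in A) (q x)%:E <= 0)%E ->
  nu A = 0%E.
Proof.
move=> mA mq q0 iq.
have : (\int[nu]_(x in A) `|(q x)%:E| = 0)%E.
  apply/eqP; rewrite eq_le integral_ge0 ?andbT//.
  rewrite (@eq_integral _ _ _ nu A (EFin \o q))// => x /set_mem /q0 /ltW qx.
  by rewrite /= ger0_norm.
have mqA : measurable_fun A (EFin \o q) by apply/measurable_EFinP/measurable_funTS.
move/(ae_eq_integral_abs nu mA mqA) => ae0.
apply: measure_negligible => //; apply: negligibleS ae0 => x Ax /= /(_ Ax) [qx].
by have := q0 x Ax; rewrite qx ltxx.
Qed.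

(** Where the density is negative, its opposite integrates to [- lam <= 0]; where it exceeds [1],
    the excess integrates to [lam - nu <= 0]. A positive function with such an integral lives on a
    null set. *)
Lemma rn_density_bounds : {ae nu, forall x, 0 <= rn_density x <= 1}.
Proof.
have ml := rn_density_measurable.
have il A : measurable A -> nu.-integrable A (EFin \o rn_density).
  by move=> mA; apply: integrableS rn_density_integrable.
pose A := [set x | rn_density x < 0]; pose B := [set x | 1 < rn_density x].
have mA : measurable A.
  have := ml measurableT `]-oo, 0[%classic; rewrite setTI => h.
  rewrite (_ : A = rn_density @^-1` `]-oo, 0[%classic); first exact: h.
  by apply/seteqP; split => x; rewrite /A /= in_itv.
have mB : measurable B.
  have := ml measurableT `]1, +oo[%classic; rewrite setTI => h.
  rewrite (_ : B = rn_density @^-1` `]1, +oo[%classic); first exact: h.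
  by apply/seteqP; split => x; rewrite /B /= in_itv /= andbT.
have A0 : nu A = 0%E.
  apply: (@null_of_integral_le0 _ (fun x => - rn_density x)) => //.
  - exact: measurableT_comp.
  - by move=> x Ax; rewrite oppr_gt0.
  rewrite (_ : (fun x => _) = (fun x => - (rn_density x)%:E)%E)//.
  rewrite integralN; last exact: integrable_add_def (il _ mA).
  rewrite rn_density_integral// oppe_le0; exact: measure_ge0.
have B0 : nu B = 0%E.
  apply: (@null_of_integral_le0 _ (fun x => rn_density x - 1)) => //.
  - exact: measurable_funB.
  - by move=> x Bx; rewrite subr_gt0.
  rewrite (_ : (fun x => _) = ((EFin \o rn_density) \- cst 1)%E)//.
  rewrite integralB//; [|exact: il|exact: finite_measure_integrable_cst].
  rewrite rn_density_integral// integral_cst// mul1e.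
  by rewrite sube_le0; exact: lam_le.
exists (A `|` B); split; first exact: measurableU.
  apply: measure_negligible; first exact: measurableU.
  by apply: negligibleU; apply/negligibleP.
move=> x /= /negP; rewrite negb_and -!ltNge => /orP[?|?]; by [left|right].
Qed.

Lemma rn_density_null (N : set X) : measurable N -> lam N = 0%E ->
  {ae nu, forall x, N x -> rn_density x = 0}.
Proof.
move=> mN N0; have ml := rn_density_measurable.
pose A := N `&` [set x | 0 < rn_density x].
have mA : measurable A.
  apply: measurableI => //.
  have := ml measurableT `]0, +oo[%classic; rewrite setTI => h.
  rewrite (_ : [set x | _] = rn_density @^-1` `]0, +oo[%classic); first exact: h.
  by apply/seteqP; split => x; rewrite /= in_itv /= andbT.
have A0 : nu A = 0%E.
  apply: (@null_of_integral_le0 _ rn_density) => //; first by move=> x [].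
  rewrite rn_density_integral// -N0; apply: le_measure; rewrite ?inE//.
  exact: subIsetl.
have aeA : {ae nu, forall x, ~ A x} by exists A; split => // x /= /contrapT.
apply: filterS2 rn_density_bounds aeA => x /andP[l0 _] nA Nx.
by apply/eqP; rewrite eq_le l0 andbT leNgt; apply/negP => h; exact: nA.
Qed.

(* [f] may be redefined on a [lam]-null set, which need not be [nu]-null, because
   the density of [lam] vanishes [nu]-a.e. there. *)
Lemma rn_density_scale (E : completeNormedModType R) (f : X -> E) (D : set X)
    (M : R) : 0 <= M -> measurable D -> lam (~` D) = 0%E ->
    (forall x, D x -> `|f x| <= M) -> strongly_measurable lam f ->
  exists2 h, bounded_limit (M + 1) h & {ae nu, forall x, h x = rn_density x *: f x}.
Proof.
move=> M0 mD D0 fM [s [hs [N0 [mN0 N00 sN0]]]].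
pose N := N0 `|` ~` D.
have mN : measurable N by apply: measurableU => //; exact: measurableC.
have lamN : lam N = 0%E.
  by apply: measure_negligible => //; apply: negligibleU; apply/negligibleP => //;
    exact: measurableC.
(* Clamping changes the density only on a [nu]-null set and makes it nonnegative everywhere, as
   approximation by simple functions requires. *)
pose l x := Num.max 0 (Num.min 1 (rn_density x)).
have l0 x : 0 <= l x by rewrite le_max lexx.
have l1 x : l x <= 1 by rewrite ge_max ler01 ge_min lexx.
have ml : measurable_fun setT l.
  apply: measurable_maxr => //; apply: measurable_minr => //.
  exact: rn_density_measurable.
have mle : measurable_fun setT (EFin \o l) by apply/measurable_EFinP.
have [ln [_ lnl]] := approximation measurableT mle (fun x _ => l0 x).
pose h x := if x \in ~` N then l x *: f x else 0.
have hS : strongly_measurable nu h.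
  exists (fun n x => if x \in ~` N then ln n x *: s n x else 0); split.
    move=> n; apply: simple_fun_restrict; first exact: measurableC.
    apply: (@simple_fun2 _ _ _ R E E (fun a b => a *: b) (ln n) (s n)); last exact: hs.
    by split => [|y]; [exact: fimfunP|exact: measurable_funPTI].
  apply: aeW => x; rewrite /h; case: ifPn => [/set_mem Nx|_]; last exact: cvg_cst.
  apply: cvgZ.
    by have /fine_cvgP[_] := lnl x Logic.I.
  by apply: contrapT => H; apply: Nx; left; exact: sN0.
have [|g hg gh] := bounded_limit_ae M0 hS.
  apply: aeW => x; rewrite /h; case: ifPn => [/set_mem Nx|_]; last by rewrite normr0.
  rewrite normrZ ger0_norm// -[leRHS]mul1r.
  apply: ler_pM => //; apply: fM; apply: contrapT => H; apply: Nx; right; exact: H.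
exists g => //; apply: filterS3 gh rn_density_bounds (rn_density_null mN lamN).
move=> x -> /andP[r0 r1] rN; rewrite /h; case: ifPn => [_|/negP].
  by rewrite /l min_r// max_r.
by rewrite inE => /contrapT/rN ->; rewrite scale0r.
Qed.

End DominatedDensity.

(** * Uniqueness by an energy estimate *)

Section Uniqueness.
Context {R : realType} {E : completeNormedModType R}.
Variables (ip : {dot E for (@idfun R)}).
Hypothesis ip_norm : norm_from_dot ip.
Variables (T : R) (rho : R -> R).
Hypothesis T_gt0 : 0 < T.
Variable nu : {finite_measure set (measurableTypeR R) -> \bar R}.
Hypothesis nu_itv : forall s t, 0 <= s -> s <= t -> t <= T ->
  nu `]s, t]%classic = (rho t - rho s)%:E.
Hypothesis rho_rc : right_continuous_on T rho.

Lemma lipschitz_right_continuous (K : R) (w : R -> E) :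
    (forall s t, 0 <= s -> s <= t -> t <= T -> `|w t - w s| <= K * (rho t - rho s)) ->
  right_continuous_on T w.
Proof.
move=> wlip t t0 tT; apply/cvgrPdistC_le => eps eps0.
have h : K * (rho s - rho t) @[s --> t^'+] --> 0.
  rewrite -(mulr0 K) -(subrr (rho t)); apply: cvgM; first exact: cvg_cst.
  by apply: cvgB; [exact: rho_rc|exact: cvg_cst].
have {}h := cvgr_le _ h eps eps0.
near=> s; apply: (@le_trans _ _ (K * (rho s - rho t))); last by near: s; exact: h.
by apply: wlip => //; near: s; exact: nbhs_right_le.
Unshelve. all: by end_near. Qed.

Section Contraction.
Variables (M : R) (k : measurableTypeR R -> E) (z : R -> E).
Hypothesis hk : @bounded_limit _ (measurableTypeR R) R E M k.
Hypothesis zE : forall t v, 0 <= t <= T ->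
  ip (z t) v = \int[nu]_(x in `]0, t]) ip (k x) v.

Lemma primitive_lip s t : 0 <= s -> s <= t -> t <= T ->
  `|z t - z s| <= M * (rho t - rho s).
Proof.
have [F [_ FE Flip]] := bochner_primitive ip_norm nu_itv hk.
have zF u : 0 <= u <= T -> z u = F u.
  by move=> uT; apply: (dot_weak_eq ip_norm) => v; rewrite zE// FE.
move=> s0 st tT; rewrite !zF; first exact: Flip.
- by rewrite s0 (le_trans st).
- by rewrite tT (le_trans s0).
Qed.

(** [z] is frozen at the right end of each cell: this makes the integral of [phi n] a finite sum,
    and [zr n] still converges to [z] on []0, T]] by right continuity. *)
Let zr n : measurableTypeR R -> E := step T n (fun i => z (node T n i.+1)).
Let phi n x := ip (k x) (zr n x).
Let B := M * (rho T - rho 0).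

Lemma primitive0 : z 0 = 0.
Proof.
apply: (dot_weak_eq ip_norm) => v.
by rewrite zE ?lexx ?ltW// set_itvoc0 Rintegral_set0 linear0l.
Qed.

Lemma primitive_bound t : 0 <= t <= T -> `|z t| <= B.
Proof.
have M0 : 0 <= M := le_trans (normr_ge0 _) (bounded_limit_le (0 : R) hk).
move=> /andP[t0 tT]; have := primitive_lip (lexx 0) t0 tT.
rewrite primitive0 subr0 => /le_trans; apply; apply: ler_wpM2l => //.
by rewrite lerD2r -subr_ge0; apply: (rho_ge0 nu_itv).
Qed.

Lemma zr_bound n x : `|zr n x| <= B.
Proof.
have B0 := le_trans (normr_ge0 _) (primitive_bound (t := 0) _).
rewrite /zr /step; case: ifP => [/andP[x0 xT]|_]; last first.
  by rewrite normr0 B0// lexx ltW.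
by apply: primitive_bound; apply: node_in => //; exact: cell_lt.
Qed.

Lemma phi_measurable n : measurable_fun setT (phi n).
Proof.
have [s [hs _ sk]] := hk.
apply: (@measurable_realfun.measurable_fun_cvg _ _ _ _
  (fun m x => ip (s m x) (zr n x))).
  move=> m; have h := @simple_fun2 _ (measurableTypeR R) R E E R ip _ _ (hs m)
    (simple_fun_step T_gt0 n (fun i => z (node T n i.+1))).
  exact: (@simple_fun_measurable _ (measurableTypeR R) R R _ id h).
by move=> x _; apply: (cvg_dot ip_norm) => //; exact: cvg_cst.
Qed.

Lemma phi_bound n x : `|phi n x| <= M * B.
Proof.
rewrite (le_trans (cauchy_schwarz ip_norm _ _))// ler_pM//.
  exact: bounded_limit_le hk.
exact: zr_bound.
Qed.

Lemma phi_integrable (D : set (measurableTypeR R)) n : measurable D ->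
  nu.-integrable D (EFin \o phi n).
Proof.
move=> mD; apply: (bounded_integrable nu mD _ (phi_bound n)).
exact: phi_measurable.
Qed.

(** On one cell the second argument of [phi n] is constant, so [zE] tested against that constant
    gives the increment exactly. *)
Lemma Rintegral_phi n j : (j <= 2 ^ n)%N ->
  \int[nu]_(x in `]0, node T n j]) phi n x =
  \sum_(0 <= i < j) ip (z (node T n i.+1) - z (node T n i)) (z (node T n i.+1)).
Proof.
elim: j => [_|j IH jN]; first by rewrite node0 set_itvoc0 Rintegral_set0 big_geq.
have j0 := node_ge0 T_gt0 n j.
have jj : node T n j <= node T n j.+1 by rewrite node_le.
have jT := node_leT T_gt0 jN.
have split_itv t u : 0 <= t -> t <= u ->
    `]0, u]%classic = (`]0, t] `|` `]t, u])%classic :> set R.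
  by move=> t0 tu; rewrite -itv_bndbnd_setU// bnd_simp.
have disj t u : [disjoint `]0, t]%classic & `]t, u]%classic :> set R].
  apply/disj_setPS => x [/=]; rewrite !in_itv/= => /andP[_ h] /andP[h' _].
  by have := lt_le_trans h' h; rewrite ltxx.
rewrite (split_itv _ _ j0 jj) Rintegral_setU//; last first.
  by apply: phi_integrable; exact: measurableU.
rewrite IH ?(ltnW jN)// big_nat_recr//=; congr (_ + _).
rewrite dotDl dotNl !zE ?j0 ?(le_trans j0 jj) ?(le_trans jj jT)//.
rewrite (split_itv _ _ j0 jj) Rintegral_setU//; last first.
  apply: (bounded_limit_dot_integrable ip_norm nu _ _ hk).
  exact: measurableU.
rewrite addrAC subrr add0r; apply: eq_Rintegral => x; rewrite inE/= in_itv/= => jx.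
rewrite /phi /zr /step (cell_unique T_gt0 jx).
by case/andP: jx => jx xj; rewrite (le_lt_trans j0 jx) (le_trans xj jT).
Qed.

Hypothesis kz_le0 : {ae nu, forall t, 0 < t <= T -> ip (k t) (z t) <= 0}.

Lemma contraction_node n0 j : (j <= 2 ^ n0)%N -> z (node T n0 j) = 0.
Proof.
move=> jN; set b := node T n0 j.
have bT : b <= T := node_leT T_gt0 jN.
have b0 : 0 <= b := node_ge0 T_gt0 n0 j.
(* At every finer level [b] is still a node, so the estimate is available along the whole tail of
   levels. *)
have le_phi n : (n0 <= n)%N ->
    `|z b| ^+ 2 <= 2 * \int[nu]_(x in `]0, b]) phi n x.
  move=> nn; rewrite /b -(node_refine T j nn); set q := (_ * _)%N.
  have qN : (q <= 2 ^ n)%N.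
    by rewrite /q -{2}(subnKC nn) expnD leq_mul2r jN orbT.
  rewrite Rintegral_phi// mulr_sumr.
  have -> : `|z (node T n q)| ^+ 2 =
      \sum_(0 <= i < q) (`|z (node T n i.+1)| ^+ 2 - `|z (node T n i)| ^+ 2).
    rewrite (telescope_sumr (fun i => `|z (node T n i)| ^+ 2))//.
    by rewrite node0 primitive0 normr0 expr0n subr0.
  apply: ler_sum => i _.
  have := normB_sqr ip_norm (z (node T n i.+1)) (z (node T n i)).
  have := exprn_ge0 2 (normr_ge0 (z (node T n i.+1) - z (node T n i))).
  rewrite dotDl dotNl (dot_sym ip (z (node T n i))) (dot_norm ip_norm); lra.
pose zz (x : R) := if 0 < x <= T then z x else 0.
(* The minimum with [0] makes the limit nonpositive everywhere; by [kz_le0] it changes nothing a.e.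
   on []0, b]]. *)
pose phi0 x := Num.min (ip (k x) (zz x)) 0.
have zr_cvg x : zr n x @[n --> \oo] --> zz x.
  rewrite /zr /zz /step; case: ifPn => [/andP[x0 xT]|_]; last exact: cvg_cst.
  apply: right_continuous_node => //.
  exact: lipschitz_right_continuous primitive_lip.
have phi_cvg x : phi n x @[n --> \oo] --> ip (k x) (zz x).
  by apply: (cvg_dot ip_norm) => //; exact: cvg_cst.
have mphi0 : measurable_fun (setT : set (measurableTypeR R)) phi0.
  apply: measurable_minr => //.
  apply: (@measurable_realfun.measurable_fun_cvg _ _ _ _ phi) => // n.
  exact: phi_measurable.
have mb : measurable (`]0, b]%classic : set (measurableTypeR R)).
  exact: measurable_itv.
have MB0 : 0 <= M * B := le_trans (normr_ge0 _) (phi_bound 0 0).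
have phi0_cvg : {ae nu, forall x : measurableTypeR R, `]0, b]%classic x ->
    (phi n x)%:E @[n --> \oo] --> (phi0 x)%:E}.
  apply: (@filterS _ _ (ae_filter_ringOfSetsType nu) _ _ _ kz_le0) => x hx.
  rewrite /= in_itv/= => /andP[x0 xb]; have xT : 0 < x <= T by rewrite x0 (le_trans xb).
  apply: cvg_EFin; first by near=> n.
  have -> : phi0 x = ip (k x) (zz x).
    by rewrite /phi0 min_l// /zz xT; exact: hx.
  exact: phi_cvg.
have mphi_b n : measurable_fun (`]0, b]%classic : set (measurableTypeR R))
    (EFin \o phi n).
  by apply/measurable_EFinP; apply: measurable_funTS; exact: phi_measurable.
have mphi0_b : measurable_fun (`]0, b]%classic : set (measurableTypeR R))
    (EFin \o phi0).
  by apply/measurable_EFinP; apply: measurable_funTS.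
have phi_dom : {ae nu, forall (x : measurableTypeR R) n, `]0, b]%classic x ->
    (`|(phi n x)%:E| <= (M * B)%:E)%E}.
  by apply: aeW => x n _; rewrite lee_fin phi_bound.
have icst : nu.-integrable (`]0, b]%classic : set (measurableTypeR R))
    (cst (M * B)%:E) by exact: finite_measure_integrable_cst.
have [iphi0 _ cvg_int] := dominated_convergence mb mphi_b mphi0_b phi0_cvg icst phi_dom.
have int_le0 : \int[nu]_(x in `]0, b]) phi0 x <= 0.
  apply: (@le_trans _ _ (\int[nu]_(x in `]0, b]) (0 : R))); last first.
    by rewrite Rintegral_cst// mul0r.
  apply: le_Rintegral => //; first exact: finite_measure_integrable_cst.
  by move=> x _; rewrite ge_min lexx orbT.
have cvgR : \int[nu]_(x in `]0, b]) phi n x @[n --> \oo] -->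
    \int[nu]_(x in `]0, b]) phi0 x.
  have := cvg_int; rewrite -(fineK (integrable_fin_num mb iphi0)).
  by move/fine_cvgP => [].
have : `|z b| ^+ 2 <= 2 * \int[nu]_(x in `]0, b]) phi0 x.
  apply: (@cvgr_to_ge _ \oo _ _ (fun n => 2 * \int[nu]_(x in `]0, b]) phi n x)).
    by apply: cvgM => //; exact: cvg_cst.
  by near=> n; apply: le_phi; near: n; exists n0.
move=> h; apply/normr0_eq0/eqP; rewrite -sqrf_eq0 eq_le exprn_ge0// andbT.
by move: h int_le0; lra.
Unshelve. all: by end_near. Qed.

(** Right continuity extends the vanishing from the dyadic nodes to all times. *)
Lemma contraction_eq0 t : 0 <= t <= T -> z t = 0.
Proof.
move=> /andP[t0 tT]; have [->|tn0] := eqVneq t 0; first exact: primitive0.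
have t0' : 0 < t by rewrite lt_neqAle eq_sym tn0.
have := right_continuous_node T_gt0 (lipschitz_right_continuous primitive_lip) t0' tT.
under eq_fun => n do rewrite contraction_node ?cell_lt//.
by move=> h; apply/esym; exact: (cvg_unique _ (cvg_cst _) h).
Qed.

End Contraction.
End Uniqueness.

(** * Excess, normal cone and variation in elementary terms *)

Section Conversions.
Context {R : realType} {E : normedModType R}.

(** The excess only yields points of [C2] within [d + e] for every [e > 0]; a nearest point attains
    the bound [d]. *)
Lemma excess_nearest (C1 C2 : set E) (x : E) (d : R) :
    (excess C1 C2 <= d%:E)%E -> C1 x -> C2 !=set0 -> ball_compact C2 ->
  exists2 y, C2 y & `|x - y| <= d.
Proof.
move=> ed C1x C20 cC2; have [p C2p pmin] := nearest_point x C20 cC2.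
exists p => //; apply/ler_addgt0Pr => e e0.
have : (edist_inf C2 x < (d + e)%:E)%E.
  apply: (@le_lt_trans _ _ d%:E); last by rewrite lte_fin ltrDl.
  by apply: le_trans ed; apply: ereal_sup_ubound; exists x.
move=> /ereal_inf_lt[_ [y C2y <-]] /edist_lt_ball; rewrite -ball_normE /= => xy.
by apply: (le_trans (pmin _ C2y)); exact: ltW.
Qed.

Lemma normal_cone_dot (ip : {dot E for (@idfun R)}) (C : set E) x xi :
  C x -> normal_cone ip C x xi <-> forall y, C y -> ip xi (y - x) <= 0.
Proof.
move=> Cx; rewrite /normal_cone /subdifferential /indicator /= mem_set//.
split => [[_ h] y Cy|h]; first by have := h y; rewrite mem_set// add0e lee_fin.
split => // y; rewrite add0e; case: ifPn => [/set_mem Cy|_]; last exact: leey.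
by rewrite lee_fin h.
Qed.

Lemma lipschitz_bounded_variation (T K : R) (rho : R -> R) (u : R -> E) :
    (forall s t, 0 <= s -> s <= t -> t <= T -> `|u t - u s| <= K * (rho t - rho s)) ->
  vector_bounded_variation 0 T u.
Proof.
move=> ulip; exists (K * (rho T - rho 0)) => _ [s hs <-].
rewrite /vector_variation; pose F i := rho (nth T (0 :: s) i).
apply: (@le_trans _ _ (\sum_(0 <= i < size s) (K * (F i.+1 - F i)))).
  apply: ler_sum_nat => i /andP[_ si]; apply: ulip.
  - exact: (itv_partition_nth_ge (ltnW si) hs).
  - by have [/(pathP T)/(_ i si)/ltW] := hs.
  - exact: (itv_partition_nth_le (si : (i.+1 < (size s).+1)%N) hs).
rewrite -mulr_sumr (telescope_sumr F)// /F (itv_partition_nth_size _ hs).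
by [].
Qed.

End Conversions.

(** * The measure [nu] on the time interval and the evolution problem *)

Section MovingSet.
Context {R : realType} {E : completeNormedModType R}.
Variables (ip : {dot E for (@idfun R)}).
Hypothesis ip_norm : norm_from_dot ip.
Variables (T : R).
Hypothesis T_gt0 : 0 < T.
Variable r : R -> R.
Hypothesis r_rc : right_continuous_on T r.
Hypothesis r_nd : {in `[0, T] &, {homo r : s t / s <= t}}.

Let nu : {finite_measure set (measurableTypeR R) -> \bar R} :=
  nu_on T_gt0 r_nd r_rc.
Let rho t := t + r t.

Lemma lebesgue_on_itv s t : 0 <= s -> s <= t -> t <= T ->
  lebesgue_on T `]s, t]%classic = (t - s)%:E.
Proof.
move=> s0 st tT; rewrite /lebesgue_on /mfrestr /mrestr setIidl; last first.
  by apply: subset_itv; rewrite bnd_simp.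
rewrite lebesgue_measure_itv /= lte_fin; case: ltP => // ts.
by have -> : s = t; [apply/eqP; rewrite eq_le st|rewrite subrr].
Qed.

Lemma nu_on_itv s t : 0 <= s -> s <= t -> t <= T ->
  nu `]s, t]%classic = (rho t - rho s)%:E.
Proof.
move=> s0 st tT.
rewrite -[LHS]/(nu_on T_gt0 r_nd r_rc `]s, t]%classic) /nu_on measure_addE.
apply: (etrans (congr2 adde (lebesgue_on_itv s0 st tT)
  (stieltjes_on_itv T_gt0 r_nd r_rc s0 st tT))).
by apply: (etrans (esym (EFinD _ _))); rewrite /rho; congr (_%:E); ring.
Qed.

Lemma lebesgue_on_out : lebesgue_on T (~` `[0, T]%classic) = 0%E.
Proof. by rewrite /lebesgue_on /mfrestr /mrestr setICl measure0. Qed.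

(** Inside [[0, T]] only the point [0] is left out, and neither Lebesgue measure nor the Stieltjes
    measure charges it. This disposes of [t = 0], where the inclusion is not constructed. *)
Lemma nu_on_out : nu (~` `]0, T]%classic) = 0%E.
Proof.
have I0 : ~` `]0, T]%classic `&` `[0, T]%classic = [set 0] `&` `[0, T]%classic :> set R.
  apply/seteqP; split => x /=; rewrite !in_itv/=.
    by move=> [h /andP[x0 xT]]; split; [apply/eqP; apply: contrapT => /negP xn0;
      apply: h; rewrite lt_neqAle eq_sym xn0 x0|rewrite x0].
  by move=> [-> _]; rewrite ltxx lexx ltW.
rewrite -[LHS]/(nu_on T_gt0 r_nd r_rc (~` `]0, T]%classic)) /nu_on measure_addE.
have l0 : lebesgue_on T (~` `]0, T]%classic) = 0%E.
  rewrite /lebesgue_on /mfrestr /mrestr I0; apply/eqP; rewrite -measure_le0.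
  rewrite -(@lebesgue_measure_set1 R 0); apply: le_measure; rewrite ?inE//.
  by apply: measurableI.
have s0 : stieltjes_on T_gt0 r_nd r_rc (~` `]0, T]%classic) = 0%E.
  rewrite -(stieltjes_on_set1 T_gt0 r_nd r_rc).
  by rewrite /stieltjes_on /mfrestr /mrestr I0.
have := congr2 (fun a b : \bar R => a + b)%E l0 s0.
by rewrite adde0; exact: etrans.
Qed.

Lemma rho_increasing s t : 0 <= s -> s < t -> t <= T -> rho s < rho t.
Proof.
move=> s0 st tT; rewrite /rho ltr_leD//; apply: r_nd; rewrite ?in_itv/=.
- by rewrite s0 (le_trans (ltW st)).
- by rewrite tT (le_trans s0 (ltW st)).
- exact: ltW.
Qed.

Lemma rho_right_continuous : right_continuous_on T rho.
Proof.
move=> t t0 tT; apply: cvgD; last exact: r_rc.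
by apply: cvg_at_right_filter.
Qed.

Variable C : R -> set E.
Variable f : R -> E.

(** The perturbation cancels in the difference of the two inclusions, and monotonicity of the normal
    cone gives the sign of [<gv - gu, v - u>]. The densities are first replaced by bounded limits
    equal to them a.e. *)
Lemma evolution_solution_unique u0 u v :
  evolution_solution ip T nu C f u0 u -> evolution_solution ip T nu C f u0 v ->
  forall t, 0 <= t <= T -> v t = u t.
Proof.
move=> [u_0 uC [gu [du [mgu gu_bd] vu]]] [v_0 vC [gv [dv [mgv gv_bd] vv]]].
have bd (g : R -> E) : (ess_sup nu (fun x => `|g x|%:E) < +oo)%E ->
    exists2 M, 0 <= M & {ae nu, forall x, `|g x| <= M}.
  move=> /ess_supr_bounded[M hM]; exists (Num.max 0 M); first by rewrite le_max lexx.
  apply: (@filterS _ _ (ae_filter_ringOfSetsType nu) _ _ _ hM) => x gM.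
  by rewrite le_max gM orbT.
have [M1 M10 guM] := bd _ gu_bd; have [M2 M20 gvM] := bd _ gv_bd.
have [ku hku kuE] := bounded_limit_ae M10 mgu guM.
have [kv hkv kvE] := bounded_limit_ae M20 mgv gvM.
have hk := bounded_limitB hkv hku.
suff zE : forall t, 0 <= t <= T -> v t - u t = 0.
  by move=> t /zE /eqP; rewrite subr_eq0 => /eqP.
apply: (@contraction_eq0 _ _ _ ip_norm T rho T_gt0 nu nu_on_itv
  rho_right_continuous _ _ (fun t => v t - u t) hk).
  move=> t y /andP[t0 tT].
  have mt : measurable (`]0, t]%classic : set (measurableTypeR R)).
    exact: measurable_itv.
  under eq_Rintegral do rewrite dotDl dotNl.
  rewrite RintegralB//; last 2 first.
    exact: (bounded_limit_dot_integrable ip_norm nu y mt hkv).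
    exact: (bounded_limit_dot_integrable ip_norm nu y mt hku).
  rewrite -(is_bochner_integral_dot ip_norm y mt hkv kvE (dv t t0 tT)).
  rewrite -(is_bochner_integral_dot ip_norm y mt hku kuE (du t t0 tT)).
  by rewrite u_0 v_0 !(dotDl, dotNl); ring.
have ffs := ae_filter_ringOfSetsType nu.
have vis : {ae nu, forall t, 0 <= t <= T ->
    0 <= ip (gu t - gv t) (v t - u t)}.
  apply: (@filterS2 _ _ ffs _ _ _ _ vu vv) => t hu hv tT.
  have /andP[t0 t1] := tT.
  have [xu nu_ eu] := hu tT; have [xv nv ev] := hv tT.
  have /(normal_cone_dot ip _ (uC t t0 t1))/(_ _ (vC t t0 t1)) := nu_.
  have /(normal_cone_dot ip _ (vC t t0 t1))/(_ _ (uC t t0 t1)) := nv.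
  have -> : gu t - gv t = xv - xu.
    rewrite -[gu t]opprK -eu -[- gv t]ev opprD addrACA addNr addr0.
    exact: addrC.
  by rewrite !(dotDl, dotNl, dotDr, dotNr); lra.
apply: (@filterS3 _ _ ffs _ _ _ _ _ vis kuE kvE) => t h -> -> /andP[t0 tT].
have := h; rewrite (ltW t0) tT => /(_ isT).
by rewrite !(dotDl, dotNl); lra.
Qed.

End MovingSet.

Theorem theorem3p4 (R : realType) (E : completeNormedModType R)
  (ip : {dot E for (@idfun R)}) (ip_norm : norm_from_dot ip)
  (E_sep : separable E)
  (T : R) (T_gt0 : 0 < T)
  (r : R -> R)
  (r_ge0 : forall t, 0 <= t <= T -> 0 <= r t)
  (r_rc : right_continuous_on T r)
  (r_nd : {in `[0, T] &, {homo r : s t / s <= t}})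
  (r_0 : r 0 = 0)
  (C : R -> set E)
  (C_neq0 : forall t, 0 <= t <= T -> C t !=set0)
  (C_closed : forall t, 0 <= t <= T -> closed (C t))
  (C_convex : forall t, 0 <= t <= T -> convex_set (C t))
  (C_dist : forall tau t, 0 <= tau -> tau <= t -> t <= T ->
    (hausdorff_dist (C t) (C tau) <= (r t - r tau)%:E)%E)
  (C_ball_compact : forall t, 0 <= t <= T -> ball_compact (C t))
  (f : R -> E)
  (f_bounded : exists M : R, forall t, 0 <= t <= T -> `|f t| <= M)
  (f_meas : strongly_measurable (lebesgue_on T) f)
  (u0 : E) (u0_C0 : C 0 u0) :
  let nu := nu_on T_gt0 r_nd r_rc in
  let is_BVRC_solution (u : R -> E) :=
    BVRC T u /\ evolution_solution ip T nu C f u0 u in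
  exists2 u : R -> E, is_BVRC_solution u &
    forall v : R -> E, is_BVRC_solution v ->
      forall t, 0 <= t <= T -> v t = u t.
Proof.
move=> nu is_BVRC_solution.
pose nuF : {finite_measure set (measurableTypeR R) -> \bar R} := nu.
suff [u solu] : exists u, is_BVRC_solution u.
  by exists u => // v [_ solv]; exact: evolution_solution_unique solu.2 solv.
pose rho t := t + r t.
have nu_itv := nu_on_itv T_gt0 r_rc r_nd.
have nu_out := nu_on_out T_gt0 r_rc r_nd.
have rho_lt := rho_increasing r_nd.
have rho_rc := rho_right_continuous r_rc.
have r_rho s t : 0 <= s -> s <= t -> t <= T -> r t - r s <= `|rho t - rho s|.
  by move=> s0 st tT; apply: le_trans (ler_norm _); rewrite /rho; lra.
have C_lip s t x : 0 <= s <= T -> 0 <= t <= T -> C s x ->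
    exists2 y, C t y & `|x - y| <= `|rho t - rho s|.
  move=> sT tT Cx; have [s0 s1] := andP sT; have [t0 t1] := andP tT.
  apply: (@excess_nearest _ _ (C s)) => //; [|exact: C_neq0|exact: C_ball_compact].
  have [st|/ltW ts] := leP s t.
    apply: (@le_trans _ _ (r t - r s)%:E); last by rewrite lee_fin r_rho.
    by have := C_dist _ _ s0 st t1; rewrite /hausdorff_dist ge_max => /andP[].
  rewrite distrC; apply: (@le_trans _ _ (r s - r t)%:E).
    by have := C_dist _ _ t0 ts s1; rewrite /hausdorff_dist ge_max => /andP[].
  by rewrite lee_fin r_rho.
have [M fM] := f_bounded.
have M0 : 0 <= M.
  by apply: le_trans (normr_ge0 (f 0)) (fM 0 _); rewrite lexx ltW.
have mI : measurable (`[0, T]%classic : set (measurableTypeR R)).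
  exact: measurable_itv.
have lam_le (A : set (measurableTypeR R)) : measurable A ->
    (lebesgue_on T A <= nuF A)%E.
  move=> mA; rewrite -[leRHS]/(nu_on T_gt0 r_nd r_rc A) /nu_on measure_addE.
  by rewrite leeDl.
have fMI (x : measurableTypeR R) : `[0, T]%classic x -> `|f x| <= M.
  by rewrite /= in_itv => /fM.
(* [h] is an everywhere bounded version of [f] times the density of Lebesgue measure. *)
have [h hh hE] := rn_density_scale lam_le M0 mI (lebesgue_on_out T) fMI f_meas.
have [L [u [g [u_0 uC hg gE vi]]]] := sweeping_exists ip_norm T_gt0 nu_itv rho_lt
  rho_rc C_neq0 C_convex C_ball_compact C_lip hh u0_C0.
have u_lip s t : 0 <= s -> s <= t -> t <= T -> `|u t - u s| <= L * (rho t - rho s).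
  move=> s0 st tT.
  (* [u - u 0] is the primitive of [g] and has the same increments as [u]. *)
  have := @primitive_lip _ _ _ ip_norm T rho nuF nu_itv L g (fun t => u t - u 0) hg
    (fun t z tT => gE t z tT) _ _ s0 st tT.
  by rewrite opprB addrA subrK.
have ffs := ae_filter_ringOfSetsType nuF.
exists u; split.
  split; first exact: lipschitz_bounded_variation u_lip.
  exact: (lipschitz_right_continuous rho_rc u_lip).
split => //; first by move=> t t0 tT; apply: uC; rewrite t0.
exists g; split.
- move=> t t0 tT; apply: (is_bochner_integral_weak ip_norm _ hg).
    exact: measurable_itv.
  by move=> z; apply: gE; rewrite t0.
- have [s [hs _ sg]] := hg; split; first by exists s; split => //; exact: aeW.
  apply: (@le_lt_trans _ _ L%:E); last exact: ltry.
  by apply/ess_supP; apply: aeW => x; rewrite lee_fin; exact: bounded_limit_le hg.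
(* [vi] speaks only of [0 < t], while the inclusion is asked on all of [[0, T]]. *)
have out0 : {ae nuF, forall t : measurableTypeR R, `]0, T]%classic t}.
  exists (~` `]0, T]%classic); split => //.
  by apply: measurableC; exact: measurable_itv.
apply: (@filterS3 _ _ ffs _ _ _ _ _ vi hE out0) => t vit hEt.
rewrite /= in_itv/= => tT' tT; exists (- (g t + h t)).
  apply/(normal_cone_dot ip); first exact: uC.
  by move=> y Cy; rewrite dotNl oppr_le0; exact: vit.
have -> : dlambda_dnu T nu t *: f t = h t by rewrite hEt.
by rewrite opprD subrK.
Qed.
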